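(* Let $l\ge 1$ and let $G$ be a group acting isometrically, non-elliptically and non-horocyclically on each of finitely many Gromov-hyperbolic spaces $X_1,\ldots,X_l$. Suppose $G$ is generated by a finite set $S$. Let $$\mathcal{SH}(G)=\{g\in G:\ g \text{ is hyperbolic on } X_i \text{ for every } 1\le i\le l\}.$$ Then there exists a constant $c\in(0,1)$ (depending on $S$, the group and the actions being fixed) such that $$\frac{\sharp\,(S^{\le n}\cap \mathcal{SH}(G))}{\sharp\, S^{\le n}}>c$$ for all sufficiently large $n$.
   Context: $S^{\le n}$ is the set of elements of $G$ that can be written as a product of at most $n$ letters in $S\cup S^{-1}$; $\sharp$ denotes cardinality. A Gromov-hyperbolic space is a geodesic metric space $X$ that is $\delta$-hyperbolic for some $\delta\ge 0$: every side of every geodesic triangle lies in the $\delta$-neighborhood of the union of the other two sides. No properness of the space or of the action is assumed. $\partial X$ denotes the Gromov boundary (equivalence classes of sequences in $X$ converging at infinity, defined through Gromov products). For an isometric action $G\curvearrowright X$ with basepoint $x_0$, the limit set is $\Lambda(G)=\{[(x_n)]\in\partial X: \exists\, g_n\in G \text{ with } x_n=g_n x_0\}$. The action is elliptic if $|\Lambda(G)|=0$ (equivalently, orbits are bounded) and horocyclic (parabolic) if $|\Lambda(G)|=1$ (equivalently, orbits are unbounded and $G$ contains no hyperbolic element). An action is non-elliptic and non-horocyclic if and only if $G$ contains at least one hyperbolic element for it. An element $g\in G$ is elliptic on $X$ if the orbits of $\langle g\rangle$ in $X$ are bounded; otherwise $g$ is hyperbolic on $X$ if it has exactly two fixed points on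 $\partial X$ and parabolic if it has exactly one. *)

(* Defs.v *)
From HB Require Import structures.
From mathcomp Require Export all_boot all_order all_algebra finmap.
From mathcomp Require Export mathcomp_extra boolp classical_sets functions.
From mathcomp Require Export cardinality reals topology normedtype sequences.
Export Order.TTheory GRing.Theory Num.Theory.
Export numFieldNormedType.Exports.

Set Implicit Arguments.
Unset Strict Implicit.
Unset Printing Implicit Defensive.

Global Open Scope classical_set_scope.
Global Open Scope ring_scope.

Section HyperbolicSpaces.
Variables (R : realType) (X : metricType R).

(* [g] is only constrained on [0, d(x, y)]. *)
Definition is_geodesic (x y : X) (g : R -> X) : Prop :=
  [/\ g 0 = x, g (mdist x y) = y &
    forall s t : R, 0 <= s <= mdist x y -> 0 <= t <= mdist x y ->
      mdist (g s) (g t) = `|s - t|].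

Definition geodesic_space : Prop :=
  forall x y : X, exists g : R -> X, is_geodesic x y g.

Definition is_segment (x y : X) (A : set X) : Prop :=
  exists g : R -> X, is_geodesic x y g /\
    A = [set g t | t in [set t : R | 0 <= t <= mdist x y]].

(* Closed neighborhood, so that trees are 0-hyperbolic. *)
Definition neighborhood (delta : R) (A : set X) : set X :=
  [set p | exists2 q, A q & mdist p q <= delta].

Definition delta_hyperbolic (delta : R) : Prop :=
  forall (x y z : X) (A B C : set X),
    is_segment y z A -> is_segment z x B -> is_segment x y C ->
    [/\ A `<=` neighborhood delta (B `|` C),
        B `<=` neighborhood delta (C `|` A) &
        C `<=` neighborhood delta (A `|` B)].

Definition gromov_hyperbolic : Prop :=
  geodesic_space /\ exists2 delta : R, 0 <= delta & delta_hyperbolic delta.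

Definition metric_bounded (A : set X) : Prop :=
  exists M : R, forall x y, A x -> A y -> mdist x y <= M.

(* The Gromov product (x | y)_o. *)
Definition gromov_product (o x y : X) : R :=
  (mdist x o + mdist y o - mdist x y) / 2.

(* (u_m | v_n)_o tends to infinity as m and n tend to infinity independently.
   On a Gromov-hyperbolic space, this, and hence everything below, does not
   depend on the choice of o. *)
Definition asymptotic (o : X) (u v : nat -> X) : Prop :=
  gromov_product o (u p.1) (v p.2) @[p --> filter_prod \oo \oo] --> +oo.

Definition converges_at_infinity (o : X) (u : nat -> X) : Prop :=
  asymptotic o u u.

Definition boundary_class (o : X) (u : nat -> X) : set (nat -> X) :=
  [set v | converges_at_infinity o v /\ asymptotic o u v].

(* A boundary point is a whole equivalence class of sequences. *)
Definition gromov_boundary (o : X) : set (set (nat -> X)) :=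
  [set xi | exists2 u, converges_at_infinity o u & xi = boundary_class o u].

End HyperbolicSpaces.

Section Actions.
Variables (R : realType) (X : metricType R) (G : groupType).
Variable act : G -> X -> X.

Definition isometric_action : Prop :=
  [/\ forall x, act 1%g x = x,
      forall g h x, act (g * h)%g x = act g (act h x) &
      forall g x y, mdist (act g x) (act g y) = mdist x y].

Definition limit_set (x0 : X) : set (set (nat -> X)) :=
  [set xi | exists g : nat -> G,
    let u := fun n => act (g n) x0 in
    converges_at_infinity x0 u /\ xi = boundary_class x0 u].

Definition elliptic_action (x0 : X) : Prop := (limit_set x0 #= `I_0)%card.

Definition horocyclic_action (x0 : X) : Prop := (limit_set x0 #= `I_1)%card.

Definition cyclic_subgroup (g : G) : set G :=
  [set h | exists n : nat, h = (g ^+ n)%g \/ h = (g ^- n)%g].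

Definition elliptic_element (g : G) : Prop :=
  forall x : X, metric_bounded [set act h x | h in cyclic_subgroup g].

Definition boundary_act (g : G) (xi : set (nat -> X)) : set (nat -> X) :=
  [set (fun n => act g (u n)) | u in xi].

Definition boundary_fixed_points (x0 : X) (g : G) : set (set (nat -> X)) :=
  [set xi | gromov_boundary x0 xi /\ boundary_act g xi = xi].

Definition hyperbolic_element (x0 : X) (g : G) : Prop :=
  ~ elliptic_element g /\ (boundary_fixed_points x0 g #= `I_2)%card.

End Actions.

Section Words.
Variables (G : groupType) (S : {fset G}).

Definition letter (x : G) : Prop := x \in S \/ (x^-1)%g \in S.

Definition word_ball (n : nat) : set G :=
  [set g | exists w : seq G,
    [/\ (size w <= n)%N, (forall x, x \in w -> letter x) &
        g = (\prod_(x <- w) x)%g]].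

Definition is_subgroup (H : set G) : Prop :=
  [/\ H 1%g, forall g h, H g -> H h -> H (g * h)%g &
      forall g, H g -> H (g^-1)%g].

Definition generates : Prop :=
  forall H : set G, is_subgroup H -> (forall s, s \in S -> H s) -> H = setT.

End Words.

(* Only meaningful on finite sets; every word ball is finite. *)
Definition card_set (T : choiceType) (A : set T) : nat := #|` fset_set A|.

Definition simultaneously_hyperbolic (R : realType) (G : groupType) (l : nat)
    (X : 'I_l -> metricType R) (act : forall i, G -> X i -> X i)
    (x0 : forall i, X i) : set G :=
  [set g | forall i, hyperbolic_element (act i) (x0 i) g].

(* Main.v *)
Require Import Defs.
From mathcomp Require Import zify lra.

Set Implicit Arguments.
Unset Strict Implicit.
Unset Printing Implicit Defensive.

(** It suffices to find a finite set [F] such that every [g] in [G] has some [f]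
    in [F] with [g f] hyperbolic on every [X_i]: the map [g |-> g f] sends the
    ball of radius [n - k], for [F] contained in the ball of radius [k], into
    the set of simultaneously hyperbolic elements of the ball of radius [n], and
    has fibers of size at most [#|F|].

    On a single space, take a loxodromic [h]. If both ends of [h] have infinite
    orbits, let [f_ab = t_a h^n s_b^-1], where the [t_a] (resp. the [s_b]) move
    the attracting (resp. repelling) end of [h] to pairwise distinct points and
    [n] is large. For any [g], the point [f_ab x] points away from [g^-1 x] for
    all but one [a]; for such an [a], the points [g f_ab x] all lie in the same
    direction, from which [f_ab^-1 x] points away for all but one [b]; and then
    [g f_ab] is loxodromic. If the end of [h] is fixed by [G], then its Busemann
    quasimorphism shows that [g h^(q j)] is loxodromic for all but one [j]. The
    remaining case of a finite, non-trivial orbit of ends is reduced to the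
    latter one by passing to a subgroup of finite index.

    For several spaces, take all the products [f_1 ... f_l] of elements of such
    families: since [g f_1 ... f_l] is conjugate to
    [f_(i+1) ... f_l g f_1 ... f_i], only a small proportion of these products
    fails on [X_i], and this proportion is less than [1 / l]. *)

(** * Gromov products in hyperbolic spaces *)

Section FourPoint.
Variables (R : realType) (X : metricType R).
Implicit Types (o x y z p q : X) (u v w : nat -> X).

Lemma gromov_productC o x y : gromov_product o x y = gromov_product o y x.
Proof. by rewrite /gromov_product (metric_sym y x); lra. Qed.

Lemma gromov_product_lel o x y : gromov_product o x y <= mdist x o.
Proof.
by have := metric_triangle y x o; rewrite /gromov_product (metric_sym y x); lra.
Qed.

Lemma gromov_product_base o o' x y :
  gromov_product o x y <= gromov_product o' x y + mdist o o'.
Proof.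
have := metric_triangle x o' o; have := metric_triangle y o' o.
by rewrite /gromov_product (metric_sym o' o); lra.
Qed.

(** Gromov's inequality [(x | y) >= min ((x | z), (z | y)) - delta], written as a disjunction so
    that uses become case analyses closed by linear arithmetic. *)
Definition four_point (delta : R) : Prop := forall o x y z,
  gromov_product o x z <= gromov_product o x y + delta \/
  gromov_product o z y <= gromov_product o x y + delta.

Lemma segment_of x y g : is_geodesic x y g ->
  is_segment x y [set g t | t in [set t : R | 0 <= t <= mdist x y]].
Proof. by move=> gg; exists g. Qed.

Lemma geodesic_dist x y (g : R -> X) t : is_geodesic x y g ->
  0 <= t <= mdist x y -> mdist x (g t) = t /\ mdist (g t) y = mdist x y - t.
Proof.
move=> [g0 g1 gd] /andP[t0 t1]; have d0 := mdist_ge0 x y; split.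
  by rewrite -{1}g0 gd ?lexx ?t0 ?d0// sub0r normrN ger0_norm.
by rewrite -{1}g1 gd ?lexx ?t0 ?d0// distrC ger0_norm// subr_ge0.
Qed.

Lemma geodesic_rev x y g : is_geodesic x y g ->
  is_geodesic y x (fun t => g (mdist x y - t)).
Proof.
move=> [g0 g1 gd]; split; first by rewrite subr0.
  by rewrite metric_sym subrr.
move=> s t; rewrite (metric_sym y x) => /andP[s0 s1] /andP[t0 t1].
rewrite gd; last 2 first.
- by apply/andP; split; lra.
- by apply/andP; split; lra.
by rewrite distrC; congr (`|_|); lra.
Qed.

(* Walking along [y, z] in unit steps, the first point far from [x, y] is near
   [x, z]. *)
Lemma geodesic_near_both delta o y z gyz goy goz : 0 <= delta ->
  delta_hyperbolic X delta ->
  is_geodesic y z gyz -> is_geodesic o y goy -> is_geodesic o z goz ->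
  exists t, [/\ 0 <= t <= mdist y z,
    exists2 s, 0 <= s <= mdist o y & mdist (gyz t) (goy s) <= delta + 1 &
    exists2 s, 0 <= s <= mdist o z & mdist (gyz t) (goz s) <= delta + 1].
Proof.
move=> d0 hyp g1 g2 g3.
have [hA _ _] := hyp _ _ _ _ _ _ (segment_of g1)
  (segment_of (geodesic_rev g3)) (segment_of g2).
have dyz := mdist_ge0 y z.
have thin t : 0 <= t <= mdist y z ->
  (exists2 s, 0 <= s <= mdist o z & mdist (gyz t) (goz s) <= delta) \/
  (exists2 s, 0 <= s <= mdist o y & mdist (gyz t) (goy s) <= delta).
  move=> ht; have [|q [] [s /= hs <-] hq] := hA (gyz t); first by exists t.
    left; exists (mdist o z - s); rewrite // (metric_sym o z).
    by move: hs => /andP[? ?]; apply/andP; split; lra.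
  by right; exists s.
pose tn n : R := Num.min n%:R (mdist y z).
have tnP n : 0 <= tn n <= mdist y z.
  by rewrite /tn le_min ler0n dyz ge_min lexx orbT.
(* If no sample point is far from the side from [o] to [y], the last sample [z] itself is near both
   sides. *)
pose far n := ~ exists2 s, 0 <= s <= mdist o y & mdist (gyz (tn n)) (goy s) <= delta.
have [[n0 fn0]|nfar] := pselect (exists n, far n); last first.
  have [n hn] : exists n : nat, mdist y z <= n%:R.
    by exists (Num.truncn (mdist y z)).+1; rewrite ltW// truncnS_gt.
  have tnn : tn n = mdist y z by rewrite /tn min_r.
  exists (tn n); split=> //.
    have [s hs hd] : exists2 s, 0 <= s <= mdist o y & mdist (gyz (tn n)) (goy s) <= delta.
      by apply: contrapT => h; apply: nfar; exists n.
    by exists s => //; lra.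
  exists (mdist o z); first by rewrite lexx mdist_ge0.
  case: g1 => _ g11 _; case: g3 => _ g31 _.
  by rewrite tnn g11 g31 mdistxx; lra.
have ex : exists n, `[< far n >] by exists n0; apply/asboolP.
case: (ex_minnP ex) => n /asboolP fn nmin.
have n_gt0 : (0 < n)%N.
  case: n fn {nmin} => // -[]; exists (mdist o y); first by rewrite lexx mdist_ge0.
  have -> : tn 0%N = 0 by rewrite /tn min_l.
  by case: g1 => -> _ _; case: g2 => _ -> _; rewrite mdistxx.
exists (tn n); split=> //.
  have [s hs hd] : exists2 s, 0 <= s <= mdist o y & mdist (gyz (tn n.-1)) (goy s) <= delta.
    apply: contrapT => h; have := nmin n.-1 (asboolT h).
    by rewrite -ltnS prednK// ltnn.
  exists s => //; apply: le_trans (metric_triangle _ (gyz (tn n.-1)) _) _.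
  suff : mdist (gyz (tn n)) (gyz (tn n.-1)) <= 1 by lra.
  case: g1 => _ _ ->//.
  have nn : n%:R = n.-1%:R + 1 :> R by rewrite -{1}(prednK n_gt0) natr1.
  rewrite /tn nn ler_norml; case: (leP (n.-1%:R + 1) (mdist y z)) => ?;
  case: (leP n.-1%:R (mdist y z)) => ?; apply/andP; split; lra.
case: (thin _ (tnP n)) => [[s hs hd]|//].
by exists s => //; lra.
Qed.

Lemma gromov_product_le_geodesic o y z g t : is_geodesic y z g ->
  0 <= t <= mdist y z -> gromov_product o y z <= mdist o (g t).
Proof.
move=> gg ht; have [h1 h2] := geodesic_dist gg ht.
have := metric_triangle y (g t) o; have := metric_triangle z (g t) o.
rewrite /gromov_product (metric_sym z (g t)) (metric_sym (g t) o); lra.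
Qed.

(** A point of the side [[x, y]] near both [[o, x]] and [[o, y]] is at distance at most
    [(x | y)_o + 2 * delta + 2] from [o]. Thinness gives a point of [[y, z]] or [[z, x]] within
    [delta] of it, and the distance from [o] to that point bounds the corresponding product. *)
Lemma gromov_hyperbolic_four_point : gromov_hyperbolic X ->
  exists2 delta, 0 < delta & four_point delta.
Proof.
move=> [geo [delta d0 hyp]]; exists (3 * delta + 2); first by lra.
move=> o x y z.
have [gxy Hxy] := geo x y; have [gox Hox] := geo o x; have [goy Hoy] := geo o y.
have [t [ht [s hs hd] [s' hs' hd']]] := geodesic_near_both d0 hyp Hxy Hox Hoy.
have tle : mdist o (gxy t) <= gromov_product o x y + 2 * delta + 2.
  have [a1 a2] := geodesic_dist Hxy ht.
  have [b1 b2] := geodesic_dist Hox hs.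
  have [c1 c2] := geodesic_dist Hoy hs'.
  have := metric_triangle o (gox s) (gxy t).
  have := metric_triangle o (goy s') (gxy t).
  have := metric_triangle x (gox s) (gxy t).
  have := metric_triangle (gxy t) (goy s') y.
  rewrite (metric_sym (gox s) (gxy t)) (metric_sym (goy s') (gxy t)).
  rewrite (metric_sym x (gox s)) /gromov_product (metric_sym x o) (metric_sym y o).
  lra.
have [gyz Hyz] := geo y z; have [gzx Hzx] := geo z x.
have [_ _ hC] := hyp _ _ _ _ _ _ (segment_of Hyz) (segment_of Hzx) (segment_of Hxy).
have [|q [] [r /= hr <-] hq] := hC (gxy t); first by exists t.
- right; rewrite gromov_productC.
  apply: le_trans (gromov_product_le_geodesic o Hyz hr) _.
  by have := metric_triangle o (gxy t) (gyz r); lra.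
- left; rewrite gromov_productC.
  apply: le_trans (gromov_product_le_geodesic o Hzx hr) _.
  by have := metric_triangle o (gxy t) (gzx r); lra.
Qed.

Definition asym o u v : Prop := forall T : R, exists N, forall n m,
  (N <= n)%N -> (N <= m)%N -> T <= gromov_product o (u n) (v m).

Lemma asymptoticE o u v : asymptotic o u v <-> asym o u v.
Proof.
rewrite /asymptotic; split.
  move=> /cvgryPge h T; have := h T; rewrite nearE => -[[/= A B] [[N1 _ hA] [N2 _ hB]] hAB].
  exists (maxn N1 N2) => n m; rewrite !geq_max => /andP[n1 n2] /andP[m1 m2].
  by apply: (hAB (n, m)); split; [exact: hA | exact: hB].
move=> h; apply/cvgryPge => T; have [N hN] := h T.
exists ([set n | (N <= n)%N], [set n | (N <= n)%N]).
  by split; exists N.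
by case=> n m /= [nN mN]; exact: hN.
Qed.

Lemma asym_sym o u v : asym o u v -> asym o v u.
Proof.
move=> h T; have [N hN] := h T; exists N => n m nN mN.
by rewrite gromov_productC; exact: hN.
Qed.

Lemma asym_trans delta o u v w : four_point delta ->
  asym o u v -> asym o v w -> asym o u w.
Proof.
move=> fp uv vw T; have [N1 h1] := uv (T + delta); have [N2 h2] := vw (T + delta).
exists (maxn N1 N2) => n m; rewrite !geq_max => /andP[n1 n2] /andP[m1 m2].
have := fp o (u n) (w m) (v (maxn N1 N2)).
have := h1 n (maxn N1 N2) n1 (leq_maxl _ _).
have := h2 (maxn N1 N2) m (leq_maxr _ _) m2.
by move=> ? ? [] ?; lra.
Qed.

(** Negating [asym] only yields arbitrarily late pairs with small product. As both sequences
    converge at infinity, the four-point inequality, applied once for each index, spreads the bound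
    to all late pairs. *)
Lemma not_asym_bounded delta o u v : four_point delta ->
  asym o u u -> asym o v v -> ~ asym o u v ->
  exists2 M, 0 <= M & exists N, forall n m, (N <= n)%N -> (N <= m)%N ->
    gromov_product o (u n) (v m) <= M.
Proof.
move=> fp uu vv uv; have [T hT] : exists T : R, forall N, exists n m,
    [/\ (N <= n)%N, (N <= m)%N & gromov_product o (u n) (v m) < T].
  apply: contrapT => h; apply: uv => T; apply: contrapT => hT; apply: h.
  exists T => N; apply: contrapT => h; apply: hT; exists N => n m nN mN.
  by rewrite leNgt; apply/negP => h'; apply: h; exists n, m.
pose M := `|T| + 2 * `|delta|.
have TM := ler_norm T; have dM := ler_norm delta.
have T0 := normr_ge0 T; have dd0 := normr_ge0 delta.
have [N1 h1] := uu (M + 1); have [N2 h2] := vv (M + 1).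
have [n0 [m0 []]] := hT (maxn N1 N2); rewrite !geq_max => /andP[n1 n2] /andP[m1 m2] hlt.
exists M; first by rewrite /M; lra.
exists (maxn N1 N2) => n m; rewrite !geq_max => /andP[n1' n2'] /andP[m1' m2'].
have := h1 n n0 n1' n1; have := h2 m m0 m2' m2.
have := fp o (u n0) (v m0) (v m); have := fp o (u n0) (v m) (u n).
rewrite (gromov_productC o (u n) (u n0)) /M.
by move=> [] ? [] ? ? ?; lra.
Qed.

End FourPoint.

(** * Hyperbolic length functions on groups *)

Section HyperbolicLength.
Variables (R : realType) (G : groupType).
Implicit Types (g h k : G) (u v w : nat -> G).

Section Length.
Variables (len : G -> R).

(* The Gromov product at [o] of [g o] and [h o], for [len g = d(g o, o)]. *)
Definition gprod g h : R := (len g + len h - len (g^-1 * h)%g) / 2.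

(** What an action on a hyperbolic space leaves visible on the orbit of a basepoint; the arguments
    on multipliers are carried out in the group with this data alone. *)
Definition hyperbolic_length (delta : R) : Prop :=
  [/\ len 1%g = 0, forall g, len g^-1%g = len g,
      forall g h, len (g * h)%g <= len g + len h &
      0 < delta /\ forall g h k, gprod g k <= gprod g h + delta \/
                                 gprod k h <= gprod g h + delta].

Definition group_asym u v : Prop := forall T : R, exists N, forall n m,
  (N <= n)%N -> (N <= m)%N -> T <= gprod (u n) (v m).

(* As [len (h ^+ 2) = 2 len h - 2 gprod h h^-1], this is
   [len (h ^+ 2) > len h + 4 delta]. *)
Definition strongly_loxodromic (delta : R) h : Prop :=
  2 * gprod h h^-1%g + 4 * delta < len h.

(** Positive stable translation length. *)
Definition loxodromic g : Prop :=
  exists e c : R, 0 < e /\ forall n, e * n%:R - c <= len (g ^+ n)%g.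

Definition pow g : nat -> G := fun n => (g ^+ n)%g.

End Length.

Variables (len : G -> R) (delta : R).
Hypothesis hyp : hyperbolic_length len delta.
Local Notation P := (gprod len).

Let len1 : len 1%g = 0. Proof. by case: hyp. Qed.
Let lenV g : len g^-1%g = len g. Proof. by case: hyp. Qed.
Let lenM g h : len (g * h)%g <= len g + len h. Proof. by case: hyp. Qed.
Let d_gt0 : 0 < delta. Proof. by case: hyp => _ _ _ []. Qed.
Let fourP g h k : P g k <= P g h + delta \/ P k h <= P g h + delta.
Proof. by case: hyp => _ _ _ []. Qed.

Lemma len_ge0 g : 0 <= len g.
Proof. by have := lenM g g^-1%g; rewrite mulgV len1 lenV; lra. Qed.

Lemma gprodC g h : P g h = P h g.
Proof.
rewrite /gprod -(lenV (g^-1 * h)%g) invgM invgK; lra.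
Qed.

Lemma gprod_ge0 g h : 0 <= P g h.
Proof. by have := lenM g^-1%g h; rewrite /gprod lenV; lra. Qed.

Lemma gprod_lel g h : P g h <= len g.
Proof.
by have := lenM g (g^-1 * h)%g; rewrite /gprod mulgA mulgV mul1g; lra.
Qed.

Lemma gprodgg g : P g g = len g.
Proof. by rewrite /gprod mulVg len1; lra. Qed.

Lemma gprod1 g : P g 1%g = 0.
Proof. by rewrite /gprod mulg1 len1 lenV; lra. Qed.

(** In the triangle with vertices [o], [g o], [h o], the products based at the two ends of the side
    from [o] to [g o] add up to its length. *)
Lemma gprod_swap g h : P g h = len g - P g^-1%g (g^-1 * h)%g.
Proof. by rewrite /gprod lenV mulgA invgK mulgV mul1g; lra. Qed.

Lemma len_mul g h : len (g * h)%g = len g + len h - 2 * P g^-1%g h.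
Proof. by rewrite /gprod invgK lenV; lra. Qed.

Lemma gprod_translate k g h :
  P (k * g)%g (k * h)%g = P g h + len k - P k^-1%g g - P k^-1%g h.
Proof. by rewrite /gprod invgM -mulgA mulKg !invgK lenV; lra. Qed.

Lemma gprod_lip g g' h : P g h <= P g' h + len (g^-1 * g')%g.
Proof.
have h1 := lenM g' (g^-1 * g')^-1%g; have h2 := lenM (g^-1 * g')^-1%g (g^-1 * h)%g.
rewrite !lenV in h1 h2; move: h1 h2; rewrite !invgM invgK mulgA mulgV mul1g.
by rewrite -mulgA (mulgA g) mulgV mul1g /gprod; lra.
Qed.

Lemma gprod_translate_ge k g h : P g h - len k <= P (k * g)%g (k * h)%g.
Proof.
rewrite gprod_translate.
by have := gprod_lel k^-1%g g; have := gprod_lel k^-1%g h; rewrite lenV; lra.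
Qed.

Lemma group_asym_sym u v : group_asym len u v -> group_asym len v u.
Proof.
move=> h T; have [N hN] := h T; exists N => n m nN mN.
by rewrite gprodC; exact: hN.
Qed.

Lemma group_asym_trans u v w :
  group_asym len u v -> group_asym len v w -> group_asym len u w.
Proof.
move=> uv vw T; have [N1 h1] := uv (T + delta); have [N2 h2] := vw (T + delta).
exists (maxn N1 N2) => n m; rewrite !geq_max => /andP[n1 n2] /andP[m1 m2].
have := fourP (u n) (w m) (v (maxn N1 N2)).
have := h1 n (maxn N1 N2) n1 (leq_maxl _ _).
have := h2 (maxn N1 N2) m (leq_maxr _ _) m2.
by move=> ? ? [] ?; lra.
Qed.

Lemma group_asym_translate k u v :
  group_asym len u v -> group_asym len (fun n => k * u n)%g (fun n => k * v n)%g.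
Proof.
move=> h T; have [N hN] := h (T + len k); exists N => n m nN mN.
by have := hN n m nN mN; have := gprod_translate_ge k (u n) (v m); lra.
Qed.

Lemma group_asym_close u v c : group_asym len u u ->
  (forall n, len ((u n)^-1 * v n)%g <= c) -> group_asym len u v.
Proof.
move=> h hc T; have [N hN] := h (T + c); exists N => n m nN mN.
have := hN n m nN mN; have := gprod_lip (u m) (v m) (u n).
have := hc m; rewrite !(gprodC _ (u n)); lra.
Qed.

Lemma not_group_asym_bounded u v :
  group_asym len u u -> group_asym len v v -> ~ group_asym len u v ->
  exists2 M, 0 <= M & exists N, forall n m, (N <= n)%N -> (N <= m)%N ->
    P (u n) (v m) <= M.
Proof.
move=> uu vv uv; have [T hT] : exists T : R, forall N, exists n m,
    [/\ (N <= n)%N, (N <= m)%N & P (u n) (v m) < T].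
  apply: contrapT => h; apply: uv => T; apply: contrapT => hT; apply: h.
  exists T => N; apply: contrapT => h; apply: hT; exists N => n m nN mN.
  by rewrite leNgt; apply/negP => h'; apply: h; exists n, m.
pose M := `|T| + 2 * delta.
have TM := ler_norm T; have T0 := normr_ge0 T; have d0 := d_gt0.
have [N1 h1] := uu (M + 1); have [N2 h2] := vv (M + 1).
have [n0 [m0 []]] := hT (maxn N1 N2); rewrite !geq_max => /andP[n1 n2] /andP[m1 m2] hlt.
exists M; first by rewrite /M; lra.
exists (maxn N1 N2) => n m; rewrite !geq_max => /andP[n1' n2'] /andP[m1' m2'].
have := h1 n n0 n1' n1; have := h2 m m0 m2' m2.
have := fourP (u n0) (v m0) (v m); have := fourP (u n0) (v m) (u n).
rewrite (gprodC (u n) (u n0)) /M.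
by move=> [] ? [] ? ? ?; lra.
Qed.

Lemma strongly_loxodromicV h :
  strongly_loxodromic len delta h -> strongly_loxodromic len delta h^-1%g.
Proof. by rewrite /strongly_loxodromic invgK gprodC lenV. Qed.

(** * Powers of a strongly loxodromic element *)

Section Strong.
Variable h : G.
Hypothesis sh : strongly_loxodromic len delta h.
Let c := P h h^-1%g.
Let hc : 2 * c + 4 * delta < len h. Proof. exact: sh. Qed.
Let c0 : 0 <= c. Proof. exact: gprod_ge0. Qed.

(** By induction and [gprod_swap], the product of [h^-1] and [h ^- n.+1] is at least
    [len h - c - delta], which exceeds [c + delta]; the four-point inequality then transfers the
    bound from [h^-1] to [h ^- n.+1]. *)
Lemma strong_gprod_expN n : P h (h ^- n)%g <= c + delta.
Proof.
elim: n => [|n IH]; first by rewrite expg0 invg1 gprod1; move: c0 d_gt0; lra.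
case: (fourP h h^-1%g (h ^- n.+1)%g) => //.
rewrite gprodC gprod_swap lenV invgK expgSr invgM mulgA mulgV mul1g.
by move: IH hc d_gt0; rewrite -/c; lra.
Qed.

End Strong.

Section StrongPowers.
Variable h : G.
Hypothesis sh : strongly_loxodromic len delta h.
Let c := P h h^-1%g.
Let hc : 2 * c + 4 * delta < len h. Proof. exact: sh. Qed.
Let c0 : 0 <= c. Proof. exact: gprod_ge0. Qed.

Lemma strong_gprodV_exp n : P h^-1%g (h ^+ n)%g <= c + delta.
Proof.
have := strong_gprod_expN (strongly_loxodromicV sh) n.
by rewrite -expVgn invgK gprodC (gprodC h^-1%g h).
Qed.

Lemma strong_lenS n : len (h ^+ n)%g + 2 * delta <= len (h ^+ n.+1)%g.
Proof.
by rewrite expgS len_mul; have := strong_gprodV_exp n; move: hc; lra.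
Qed.

Lemma strong_len n : 2 * delta * n%:R <= len (h ^+ n)%g.
Proof.
elim: n => [|n IH]; first by rewrite mulr0 len_ge0.
by rewrite -natr1; have := strong_lenS n; move: IH; lra.
Qed.

Lemma strong_len_mono n m : (n <= m)%N -> len (h ^+ n)%g <= len (h ^+ m)%g.
Proof.
move=> /subnK <-; elim: (m - n)%N => [|k IH] //.
by rewrite addSn; have := strong_lenS (k + n); move: IH d_gt0; lra.
Qed.

Lemma strong_loxodromic : loxodromic len h.
Proof.
exists (2 * delta), 0; split; first by move: d_gt0; lra.
by move=> n; rewrite subr0 strong_len.
Qed.

Lemma strong_gprod_exp_expN (m k : nat) : P (h ^+ m)%g (h ^- k)%g <= c + 2 * delta.
Proof.
case: k => [|k].
  by rewrite expg0 invg1 gprod1; move: c0 d_gt0 => ? ?; rewrite addr_ge0// mulr_ge0// ltW.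
have h1 := strong_gprodV_exp m.
case: (fourP (h ^+ m)%g h^-1%g (h ^- k.+1)%g).
  by move=> ?; rewrite gprodC in h1; lra.
rewrite (gprodC _ h^-1%g) gprod_swap lenV invgK expgSr invgM mulgA mulgV mul1g.
have := strong_gprod_expN sh k; move: h1 hc d_gt0; rewrite (gprodC h^-1%g) -/c; lra.
Qed.

(** By [gprod_swap] the defect is a product of opposite powers of [h], which is bounded: the powers
    of [h] move in one direction. *)
Lemma strong_gprod_exp n m : (n <= m)%N ->
  len (h ^+ n)%g - (c + 2 * delta) <= P (h ^+ n)%g (h ^+ m)%g.
Proof.
move=> nm; rewrite gprod_swap -(subnKC nm) expgnDr mulgA mulVg mul1g gprodC.
by have := strong_gprod_exp_expN (m - n) n; lra.
Qed.

Lemma strong_asym : group_asym len (pow h) (pow h).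
Proof.
move=> T; pose N := (Num.truncn ((`|T| + c + 2 * delta) / (2 * delta))).+1.
have hN n : (N <= n)%N -> T + c + 2 * delta <= len (h ^+ n)%g.
  move=> Nn; apply: le_trans (strong_len_mono Nn); apply: le_trans (strong_len N).
  have := truncnS_gt ((`|T| + c + 2 * delta) / (2 * delta)).
  rewrite -/N ltr_pdivrMr ?mulr_gt0// => hlt.
  by have := ler_norm T; move: hlt; lra.
exists N => n m nN mN; rewrite /pow.
case: (leqP n m) => [nm|/ltnW mn].
  by have := strong_gprod_exp nm; have := hN n nN; lra.
by rewrite gprodC; have := strong_gprod_exp mn; have := hN m mN; lra.
Qed.

Lemma strong_asymV : ~ group_asym len (pow h) (pow h^-1%g).
Proof.
move=> /(_ (c + 2 * delta + 1))[N /(_ N N (leqnn _) (leqnn _))].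
by rewrite /pow expVgn; have := strong_gprod_exp_expN N N; lra.
Qed.

End StrongPowers.

Lemma loxodromic_exp g m : (0 < m)%N -> loxodromic len g ->
  loxodromic len (g ^+ m)%g.
Proof.
move=> m0 [e [c [e0 hg]]]; exists e, c; split=> // n; rewrite -expgnA.
apply: le_trans (hg (m * n)%N); rewrite lerD2r ler_pM2l// ler_nat.
by rewrite leq_pmull.
Qed.

Lemma loxodromic_conj g k : loxodromic len g -> loxodromic len (k * g * k^-1)%g.
Proof.
move=> [e [c [e0 hg]]]; exists e, (c + 2 * len k); split=> // n.
have -> : ((k * g * k^-1) ^+ n)%g = (k * g ^+ n * k^-1)%g.
  elim: n => [|n IH]; first by rewrite !expg0 mulg1 mulgV.
  by rewrite !expgS IH !mulgA mulgVK.
have e1 : (g ^+ n = k^-1 * (k * g ^+ n * k^-1) * k)%g.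
  by rewrite !mulgA mulgVK mulVg mul1g.
have := hg n; rewrite {1}e1.
have := lenM k^-1%g (k * g ^+ n * k^-1)%g.
have := lenM (k^-1 * (k * g ^+ n * k^-1))%g k; rewrite lenV; lra.
Qed.

Lemma loxodromicC g k : loxodromic len (g * k)%g -> loxodromic len (k * g)%g.
Proof. by move=> /(loxodromic_conj k); rewrite !mulgA mulgK. Qed.

(* If no power of [g] is strongly loxodromic, then doubling the exponent adds at
   most [4 delta] to the length, so the length grows only logarithmically. *)
Lemma loxodromic_strong_exp g : loxodromic len g ->
  exists2 m, (0 < m)%N & strongly_loxodromic len delta (g ^+ m)%g.
Proof.
move=> [e [c [e0 hg]]]; apply: contrapT => no.
have dbl m : (0 < m)%N -> len (g ^+ (2 * m))%g <= len (g ^+ m)%g + 4 * delta.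
  move=> m0; rewrite leNgt; apply/negP => hlt; apply: no; exists m => //.
  rewrite /strongly_loxodromic; move: hlt.
  by rewrite mul2n -addnn expgnDr len_mul (gprodC _^-1%g); lra.
have lin i : len (g ^+ (2 ^ i))%g <= len g + 4 * delta * i%:R.
  elim: i => [|i IH]; first by rewrite expn0 expg1; lra.
  by rewrite expnS -natr1; have := dbl (2 ^ i)%N; rewrite expn_gt0 => /(_ isT); lra.
(* As [2 ^ (2 * j)] is at least [(j + 1) ^ 2], linear growth makes the length at this exponent at
   least quadratic in [j], against the upper bound [len g + 8 * delta * j]. The value of [B] makes
   [j] large enough for a contradiction. *)
pose B := (`|len g + c| + 8 * delta) / e.
pose j := Num.truncn B.
have jB : B < j%:R + 1 by rewrite natr1; exact: truncnS_gt.
have jB' : `|len g + c| + 8 * delta < e * (j%:R + 1).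
  by rewrite (mulrC e) -ltr_pdivrMr.
have sq : ((j%:R + 1) * (j%:R + 1) : R) <= (2 ^ (2 * j))%:R.
  rewrite natr1 -natrM ler_nat mul2n -addnn expnD.
  by rewrite leq_mul// ltn_expl.
have := lin (2 * j)%N; have := hg (2 ^ (2 * j))%N.
have : e * ((j%:R + 1) * (j%:R + 1)) <= e * (2 ^ (2 * j))%:R.
  by rewrite ler_pM2l.
have : (`|len g + c| + 8 * delta) * (j%:R + 1) < e * (j%:R + 1) * (j%:R + 1).
  by rewrite ltr_pM2r// ltr_wpDl.
have := ler_norm (len g + c); have j0 : (0 : R) <= j%:R by rewrite ler0n.
have : 0 <= `|len g + c| * j%:R by rewrite mulr_ge0.
rewrite natrM; move: d_gt0; nra.
Qed.

(* If neither [g] nor [h] is strongly loxodromic, then [g^-1 o] and [g o], and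
   likewise [h^-1 o] and [h o], point in the same direction; as [g o] and [h o]
   point in different directions, [g h^-1] is strongly loxodromic. *)
Lemma strong_of_divergent u v :
  group_asym len u u -> group_asym len v v -> ~ group_asym len u v ->
  exists n m, [\/ strongly_loxodromic len delta (u n),
                  strongly_loxodromic len delta (v m) |
                  strongly_loxodromic len delta (u n * (v m)^-1)%g].
Proof.
move=> uu vv uv; have [M M0 [N hM]] := not_group_asym_bounded uu vv uv.
pose B := 8 * M + 40 * delta.
have [N1 h1] := uu B; have [N2 h2] := vv B.
pose n := maxn N (maxn N1 N2).
have [n0 n1 n2] : [/\ (N <= n)%N, (N1 <= n)%N & (N2 <= n)%N].
  by rewrite /n; split; lia.
have := h1 n n n1 n1; have := h2 n n n2 n2; rewrite !gprodgg.
have := hM n n n0 n0; set g := u n; set k := v n => gk lk lg.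
exists n, n; apply: contrapT => no.
have ng : len g <= 2 * P g g^-1%g + 4 * delta.
  by rewrite leNgt; apply/negP => ?; apply: no; constructor 1.
have nk : len k <= 2 * P k k^-1%g + 4 * delta.
  by rewrite leNgt; apply/negP => ?; apply: no; constructor 2.
apply: no; constructor 3; rewrite -/g -/k.
have d0 := d_gt0.
have gVkV : P g^-1%g k^-1%g <= M + 2 * delta.
  case: (fourP g k k^-1%g) => a1.
    case: (fourP g k^-1%g g^-1%g) => a2; first by move: lg lk; rewrite /B; lra.
    by rewrite -/g -/k; lra.
  by rewrite (gprodC k^-1%g) in a1; move: lg lk; rewrite /B; lra.
(* Up to a bounded error these products are the full lengths of [g] and [k]: [g k^-1] points in the
   direction of [g] and its inverse [k g^-1] in that of [k], so they diverge as [g] and [k] do. *)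
have e1 : P g (g * k^-1)%g = len g - P g^-1%g k^-1%g.
  by rewrite gprod_swap mulgA mulVg mul1g.
have e2 : P k (k * g^-1)%g = len k - P g^-1%g k^-1%g.
  by rewrite gprod_swap mulgA mulVg mul1g gprodC.
have uw : P (g * k^-1)%g (k * g^-1)%g <= M + 2 * delta.
  case: (fourP g k (k * g^-1)%g) => a1; last first.
    by rewrite (gprodC _ k) e2 in a1; move: lg lk; rewrite /B; lra.
  case: (fourP g (k * g^-1)%g (g * k^-1)%g) => a2.
    by rewrite e1 in a2; move: lg lk; rewrite /B; lra.
  by rewrite -/g -/k; lra.
rewrite /strongly_loxodromic invgM invgK len_mul lenV.
by move: lg lk; rewrite /B; lra.
Qed.

End HyperbolicLength.

(** * Multipliers for a single length function *)

Lemma sum_at_most_one (I : finType) (p : pred I) :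
  (forall a b, p a -> p b -> a = b) -> (\sum_(i : I) p i <= 1)%N.
Proof.
move=> h; rewrite -big_mkcond/= sum1_card; apply/card_le1_eqP => a b.
by rewrite !unfold_in => ? ?; apply/esym/h.
Qed.

(** The exceptional row contributes at most [n], and each other row at most one. *)
Lemma sum2_at_most_one n (A : pred 'I_n) (B : 'I_n -> pred 'I_n) :
  (forall a b, A a -> A b -> a = b) ->
  (forall a, ~~ A a -> forall b c, B a b -> B a c -> b = c) ->
  (\sum_(a < n) \sum_(b < n) B a b <= 2 * n)%N.
Proof.
move=> hA hB; apply: (@leq_trans (\sum_(a < n) (A a * n + 1))).
  apply: leq_sum => a _; case: (boolP (A a)) => hAa.
    rewrite mul1n; apply: leq_trans (leq_addr _ _).
    rewrite -[X in (_ <= X)%N]card_ord -sum1_card; apply: leq_sum => b _.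
    by case: (B a b).
  by rewrite mul0n add0n; apply: sum_at_most_one; exact: hB.
rewrite big_split/= -big_distrl/= sum1_card card_ord mul2n -addnn leq_add2r.
by rewrite -[X in (_ <= X)%N]mul1n leq_mul2r sum_at_most_one ?orbT.
Qed.

Lemma eventually_below (Q : nat -> nat -> Prop) n :
  (forall a, (a < n)%N -> exists k, forall j, (k <= j)%N -> Q a j) ->
  exists k, forall j, (k <= j)%N -> forall a, (a < n)%N -> Q a j.
Proof.
elim: n => [|n IH] h; first by exists 0%N.
have [k1 h1] := IH (fun a an => h a (ltnW an)).
have [k2 h2] := h n (ltnSn n).
exists (maxn k1 k2) => j; rewrite geq_max => /andP[j1 j2] a.
by rewrite ltnS leq_eqVlt => /orP[/eqP->|an]; [exact: h2|exact: h1].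
Qed.

(** * Families of multipliers with few failures *)

Section Mixing.
Variables (R : realType) (G : groupType) (H : set G).
Hypothesis sgH : is_subgroup H.
Implicit Types (g h : G) (s : seq G).

Let H1 : H 1%g. Proof. by case: sgH. Qed.
Let HM g h : H g -> H h -> H (g * h)%g. Proof. by case: sgH => _ + _; apply. Qed.
Let HV g : H g -> H g^-1%g. Proof. by case: sgH => _ _; apply. Qed.
Let HX g n : H g -> H (g ^+ n)%g.
Proof. by move=> hg; elim: n => [|n IH]; rewrite ?expg0// expgS; exact: HM. Qed.

(** Failures are counted along the sequence, with multiplicity; what matters later is that the ratio
    [m / M] can be made small. *)
Definition mixing (good : set G) (M m : nat) s : Prop :=
  [/\ size s = M, forall k, k \in s -> H k &
      forall g, H g -> (\sum_(k <- s) ~~ `[< good (g * k)%g >] <= m)%N].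

Section OneLength.
Variables (len : G -> R) (delta : R).
Hypothesis hyp : hyperbolic_length len delta.
Local Notation P := (gprod len).

Let d_gt0 : 0 < delta. Proof. by case: hyp => _ _ _ []. Qed.
Let lenV g : len g^-1%g = len g. Proof. by case: hyp. Qed.
Let fourP g h k : P g k <= P g h + delta \/ P k h <= P g h + delta.
Proof. by case: hyp => _ _ _ []. Qed.

(** The index [a] governs the direction of [f a b], and [b] that of its inverse; [C] bounds products
    across distinct directions, [D] bounds from below those within one direction. *)
Lemma mixing_of_separated n (f : nat -> nat -> G) (C D : R) :
  0 <= C -> 4 * C + 12 * delta < D ->
  (forall a b, (a < n)%N -> (b < n)%N -> H (f a b)) ->
  (forall a b a' b', (a < n)%N -> (b < n)%N -> (a' < n)%N -> (b' < n)%N ->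
     a != a' -> P (f a b) (f a' b') <= C) ->
  (forall a b b', (a < n)%N -> (b < n)%N -> (b' < n)%N -> b != b' ->
     P (f a b)^-1%g (f a b')^-1%g <= C) ->
  (forall a b b', (a < n)%N -> (b < n)%N -> (b' < n)%N ->
     D <= P (f a b) (f a b')) ->
  exists s, mixing (loxodromic len) (n * n) (2 * n) s.
Proof.
move=> C0 CD Hf sep sepV close; have d0 := d_gt0.
exists [seq f a b | a <- index_iota 0 n, b <- index_iota 0 n]; split.
- by rewrite size_allpairs size_iota subn0.
- move=> k /allpairsP[[a b] /= [+ + ->]]; rewrite !mem_index_iota/=.
  exact: Hf.
move=> g Hg; rewrite big_allpairs_dep big_mkord.
under eq_bigr do rewrite big_mkord.
(* The exceptional row: some [f a b] in it points towards [g^-1]. *)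
pose A (a : 'I_n) := [exists b : 'I_n, C + delta < P (f a b) g^-1%g].
have hA (a a' : 'I_n) : A a -> A a' -> a = a'.
  move=> /existsP[b h1] /existsP[b' h2]; apply: contrapT => /eqP aa'.
  have := sep a b a' b' (ltn_ord _) (ltn_ord _) (ltn_ord _) (ltn_ord _) aa'.
  by have := fourP (f a b) (f a' b') g^-1%g; rewrite (gprodC hyp g^-1%g); lra.
apply: (sum2_at_most_one hA) => a /existsPn nA b b' bad1 bad2.
have {}nA (c : 'I_n) : P (f a c) g^-1%g <= C + delta by rewrite leNgt nA.
have large (c : 'I_n) : D <= len (f a c).
  by have := close a c c (ltn_ord _) (ltn_ord _) (ltn_ord _); rewrite (gprodgg hyp).
(* Outside the exceptional row, [(g * f a c)^-1] points in the direction of [(f a c)^-1]. If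
   [g * f a c] diverges from the latter, it diverges from its own inverse and is strongly
   loxodromic. *)
have image (c : 'I_n) : ~~ `[< loxodromic len (g * f a c)%g >] ->
    C + 2 * delta < P (g * f a c)%g (f a c)^-1%g.
  move=> /asboolPn nlox; rewrite ltNge; apply/negP => hle; apply: nlox.
  apply: (strong_loxodromic hyp).
  have e1 : P (f a c)^-1%g (g * f a c)^-1%g = len (f a c) - P (f a c) g^-1%g.
    by rewrite invgM (gprod_swap hyp) lenV invgK mulgA mulgV mul1g.
  have e2 : P (g * f a c)%g (g * f a c)^-1%g <= C + 3 * delta.
    case: (fourP (g * f a c)%g (f a c)^-1%g (g * f a c)^-1%g) => h1; first by lra.
    by rewrite (gprodC hyp) e1 in h1; have := nA c; have := large c; lra.
  rewrite /strongly_loxodromic (len_mul hyp) (gprodC hyp g^-1%g).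
  by have := nA c; have := large c; have := len_ge0 hyp g; lra.
have far : D - 2 * (C + delta) <= P (g * f a b)%g (g * f a b')%g.
  rewrite (gprod_translate hyp) !(gprodC hyp g^-1%g).
  have := close a b b' (ltn_ord _) (ltn_ord _) (ltn_ord _).
  by have := nA b; have := nA b'; have := len_ge0 hyp g; lra.
apply: contrapT => /eqP bb'.
have := sepV a b b' (ltn_ord _) (ltn_ord _) (ltn_ord _) bb'.
(* Two failures in one row would align [(f a b)^-1], [g * f a b], [g * f a b'] and [(f a b')^-1]
   successively, contradicting [sepV]. *)
have := image b bad1; have := image b' bad2.
have := fourP (f a b)^-1%g (f a b')^-1%g (g * f a b)%g.
have := fourP (g * f a b)%g (f a b')^-1%g (g * f a b')%g.
rewrite (gprodC hyp (f a b)^-1%g (g * f a b)%g).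
by move=> [] ? [] ? ? ? ?; lra.
Qed.

(** Index threshold and bound are merged into one natural number [j], so that finitely many
    instances can be combined by [eventually_below]. *)
Lemma not_asym_eventually_bounded (u v : nat -> G) :
  group_asym len u u -> group_asym len v v -> ~ group_asym len u v ->
  exists k, forall j, (k <= j)%N -> forall n m, (j <= n)%N -> (j <= m)%N ->
    P (u n) (v m) <= j%:R.
Proof.
move=> uu vv uv; have [M M0 [N hM]] := not_group_asym_bounded hyp uu vv uv.
exists (maxn N (Num.truncn M).+1) => j; rewrite geq_max => /andP[j1 j2] n m jn jm.
apply: (le_trans (hM n m (leq_trans j1 jn) (leq_trans j1 jm))).
by apply: le_trans (ltW (truncnS_gt M)) _; rewrite ler_nat.
Qed.

Lemma separated_bounded h (t : nat -> G) n :
  strongly_loxodromic len delta h ->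
  (forall a b, (a < n)%N -> (b < n)%N -> a != b ->
     ~ group_asym len (fun i => t a * pow h i)%g (fun i => t b * pow h i)%g) ->
  exists k, forall j, (k <= j)%N -> forall a b, (a < n)%N -> (b < n)%N -> a != b ->
    forall i, (j <= i)%N -> P (t a * h ^+ i)%g (t b * h ^+ i)%g <= j%:R.
Proof.
move=> sh ht.
pose Q a b j := a != b -> forall i, (j <= i)%N ->
  P (t a * h ^+ i)%g (t b * h ^+ i)%g <= j%:R.
suff [k hk] : exists k, forall j, (k <= j)%N -> forall a, (a < n)%N ->
    forall b, (b < n)%N -> Q a b j.
  by exists k => j kj a b an bn; exact: hk.
apply: eventually_below => a an.
apply: (@eventually_below (fun b j => Q a b j)) => b bn.
case: (eqVneq a b) => [<-|ab]; first by exists 0%N => j _; rewrite /Q eqxx.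
have tt c := group_asym_translate hyp (t c) (strong_asym hyp sh).
have [k hk] := not_asym_eventually_bounded (tt a) (tt b) (ht a b an bn ab).
by exists k => j kj _ i ji; exact: (hk j).
Qed.

Lemma len_eventually_bounded (t : nat -> G) n :
  exists k, forall j, (k <= j)%N -> forall a, (a < n)%N -> len (t a) <= j%:R.
Proof.
apply: eventually_below => a _; exists (Num.truncn (len (t a))).+1 => j kj.
by apply: le_trans (ltW (truncnS_gt (len (t a)))) _; rewrite ler_nat.
Qed.

Lemma mixing_of_infinite_orbits h n (t r : nat -> G) :
  strongly_loxodromic len delta h -> H h ->
  (forall a, (a < n)%N -> H (t a)) -> (forall a, (a < n)%N -> H (r a)) ->
  (forall a b, (a < n)%N -> (b < n)%N -> a != b ->
     ~ group_asym len (fun i => t a * pow h i)%g (fun i => t b * pow h i)%g) ->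
  (forall a b, (a < n)%N -> (b < n)%N -> a != b ->
     ~ group_asym len (fun i => r a * pow h^-1 i)%g (fun i => r b * pow h^-1 i)%g) ->
  exists s, mixing (loxodromic len) (n * n) (2 * n) s.
Proof.
move=> sh Hh Ht Hr sept sepr; have shV := strongly_loxodromicV hyp sh.
have [k1 h1] := separated_bounded sh sept.
have [k2 h2] := separated_bounded shV sepr.
have [k3 h3] := len_eventually_bounded t n.
have [k4 h4] := len_eventually_bounded r n.
pose j := maxn (maxn k1 k2) (maxn k3 k4).
have [j1 j2 j3 j4] : [/\ (k1 <= j)%N, (k2 <= j)%N, (k3 <= j)%N & (k4 <= j)%N].
  by rewrite /j; split; lia.
have {}h1 := h1 j j1; have {}h2 := h2 j j2; have {}h3 := h3 j j3; have {}h4 := h4 j j4.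
have d0 := d_gt0; have J0 : (0 : R) <= j%:R by rewrite ler0n.
(* The separation constant will be [3 * j]: one [j] from the separation of the translates and one
   for each of the two factors [(r b)^-1] or [(t a)^-1] dropped. The lower bound [D] loses another
   [3 * j], for two factors [(r b)^-1] and one [t a]. *)
pose D : R := 4 * (3 * j%:R) + 12 * delta + 1.
have [N hN] := strong_asym hyp sh (D + 3 * j%:R).
pose i := maxn N j; have [Ni ji] : (N <= i)%N /\ (j <= i)%N by rewrite /i; lia.
have li : D + 3 * j%:R <= len (h ^+ i)%g by have := hN i i Ni Ni; rewrite (gprodgg hyp).
pose f a b := (t a * h ^+ i * (r b)^-1)%g.
have fV a b : (f a b)^-1%g = (r b * h^-1 ^+ i * (t a)^-1)%g.
  by rewrite /f !invgM invgK mulgA expVgn.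
have near a b k : (b < n)%N -> P (f a b) k <= P (t a * h ^+ i)%g k + j%:R.
  move=> bn; apply: le_trans (gprod_lip hyp _ (t a * h ^+ i)%g _) _.
  rewrite lerD2l /f invgM invgK -mulgA mulVg mulg1; exact: h4.
have near' a b k : (b < n)%N -> P (t a * h ^+ i)%g k <= P (f a b) k + j%:R.
  move=> bn; apply: le_trans (gprod_lip hyp _ (f a b) _) _.
  rewrite lerD2l /f mulKg lenV; exact: h4.
have nearV a b k : (a < n)%N -> P (f a b)^-1%g k <= P (r b * h^-1 ^+ i)%g k + j%:R.
  move=> an; apply: le_trans (gprod_lip hyp _ (r b * h^-1 ^+ i)%g _) _.
  rewrite lerD2l fV invgM invgK -mulgA mulVg mulg1; exact: h3.
apply: (@mixing_of_separated n f (3 * j%:R) D) => //.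
- by rewrite mulr_ge0.
- by rewrite /D; lra.
- by move=> a b an bn; apply: HM; [apply: HM; [exact: Ht|exact: HX]|apply: HV; exact: Hr].
- move=> a b a' b' an bn an' bn' aa'.
  have := near a b (f a' b') bn; have := near a' b' (t a * h ^+ i)%g bn'.
  rewrite !(gprodC hyp _ (t a * h ^+ i)%g).
  by have := h1 a a' an an' aa' i ji; lra.
- move=> a b b' an bn bn' bb'.
  have := nearV a b (f a b')^-1%g an; have := nearV a b' (r b * h^-1 ^+ i)%g an.
  rewrite !(gprodC hyp _ (r b * h^-1 ^+ i)%g).
  by have := h2 b b' bn bn' bb' i ji; lra.
move=> a b b' an bn bn'.
have := near' a b (t a * h ^+ i)%g bn; have := near' a b' (f a b) bn'.
rewrite (gprodgg hyp) (gprodC hyp (f a b) (t a * _)%g) (gprodC hyp (f a b') (f a b)).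
have := h3 a an; have := len_mul hyp (t a) (h ^+ i)%g.
by have := gprod_lel hyp (t a)^-1%g (h ^+ i)%g; rewrite lenV; lra.
Qed.

End OneLength.
End Mixing.

(** * Subgroups fixing an end, and orbits of ends *)

Section FixedEnd.
Variables (R : realType) (G : groupType) (len : G -> R) (delta : R).
Hypothesis hyp : hyperbolic_length len delta.
Implicit Types (g h : G) (H : set G).
Local Notation P := (gprod len).

Let d_gt0 : 0 < delta. Proof. by case: hyp => _ _ _ []. Qed.
Let len1 : len 1%g = 0. Proof. by case: hyp. Qed.
Let fourP g h k : P g k <= P g h + delta \/ P k h <= P g h + delta.
Proof. by case: hyp => _ _ _ []. Qed.

Definition fixes_end H h : Prop :=
  forall t, H t -> group_asym len (pow h) (fun n => t * pow h n)%g.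

Definition fixed_end H : Prop :=
  exists h, [/\ strongly_loxodromic len delta h, H h & fixes_end H h].

Section Busemann.
Variables (H : set G) (h : G).
Hypothesis sgH : is_subgroup H.
Hypothesis sh : strongly_loxodromic len delta h.
Hypothesis Hh : H h.
Hypothesis fixH : fixes_end H h.

Let HX g n : H g -> H (g ^+ n)%g.
Proof.
case: sgH => H1 HM _ hg; elim: n => [|n IH]; rewrite ?expg0// expgS; exact: HM.
Qed.

(* For large [n] this is, up to a bounded error, the Busemann function of the
   end of [h], which is a quasimorphism on the stabilizer of this end. *)
Definition busemann (n : nat) g : R := len g - 2 * P g (pow h n).

Lemma busemannE n g : busemann n g = len (g^-1 * pow h n)%g - len (pow h n).
Proof. by rewrite /busemann /gprod; lra. Qed.

Lemma busemann_bound n g : `|busemann n g| <= len g.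
Proof.
rewrite ler_norml /busemann.
have := gprod_lel hyp g (pow h n); have := gprod_ge0 hyp g (pow h n).
by move=> ? ?; apply/andP; split; lra.
Qed.

Lemma gprod_close g u v : len g + delta < P u v -> `|P g u - P g v| <= delta.
Proof.
move=> huv; have := gprod_lel hyp g u; have := gprod_lel hyp g v.
have := fourP g u v; have := fourP g v u; rewrite (gprodC hyp v u).
by move=> [] ? [] ? ? ?; rewrite ler_norml; apply/andP; split; lra.
Qed.

Lemma busemann_cauchy g : exists N, forall n m, (N <= n)%N -> (N <= m)%N ->
  `|busemann n g - busemann m g| <= 2 * delta.
Proof.
have [N hN] := strong_asym hyp sh (len g + delta + 1).
exists N => n m nN mN; have hnm := hN n m nN mN.
have : `|P g (pow h n) - P g (pow h m)| <= delta by apply: gprod_close; lra.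
by rewrite /busemann !ler_norml => /andP[? ?]; apply/andP; split; lra.
Qed.

(** Since [g^-1] fixes the end, [g^-1 h^n] is aligned with [h^n] far beyond [k], and replacing one
    by the other in the product with [k] costs at most [delta]. *)
Lemma busemannM g k : H g -> exists N, forall n, (N <= n)%N ->
  `|busemann n (g * k)%g - busemann n k - busemann n g| <= 2 * delta.
Proof.
move=> Hg; have HgV : H g^-1%g by case: sgH => _ _; apply.
have [N hN] := fixH HgV (len k + delta + 1).
exists N => n nN; have hn := hN n n nN nN.
have : `|P k (pow h n) - P k (g^-1 * pow h n)%g| <= delta.
  by apply: gprod_close; lra.
rewrite !busemannE invgM -mulgA /gprod !ler_norml => /andP[? ?].
by apply/andP; split; lra.
Qed.

Lemma busemannX g k : H g -> exists N, forall n, (N <= n)%N ->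
  `|busemann n (g ^+ k)%g - k%:R * busemann n g| <= 2 * delta * k%:R.
Proof.
move=> Hg; elim: k => [|k [N1 h1]].
  exists 0%N => n _; rewrite expg0 mul0r mulr0 subr0.
  by rewrite /busemann (gprodC hyp) (gprod1 hyp) len1 mulr0 subr0 normr0.
have [N2 h2] := busemannM (g ^+ k)%g Hg.
exists (maxn N1 N2) => n; rewrite geq_max => /andP[n1 n2].
have := h1 n n1; have := h2 n n2; rewrite expgS -natr1 !ler_norml.
by move=> /andP[? ?] /andP[? ?]; apply/andP; split; lra.
Qed.

(** The value at [g ^+ k] has size at least [3 * delta * k - 2 * delta * k], and it is a lower bound
    for the length. *)
Lemma loxodromic_of_busemann g : H g ->
  (exists N, forall n, (N <= n)%N -> 3 * delta <= `|busemann n g|) ->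
  loxodromic len g.
Proof.
move=> Hg [N hN]; exists delta, 0; split=> [|k]; first exact: d_gt0.
have [N' hN'] := busemannX k Hg.
have := hN _ (leq_maxl N N'); have := hN' _ (leq_maxr N N').
set n := maxn N N'; have := busemann_bound n (g ^+ k)%g.
have k0 : (0 : R) <= k%:R by rewrite ler0n.
move=> h1 h2 h3.
have : `|k%:R * busemann n g| <= len (g ^+ k)%g + 2 * delta * k%:R.
  have -> : k%:R * busemann n g = busemann n (g ^+ k)%g -
    (busemann n (g ^+ k)%g - k%:R * busemann n g) by lra.
  by apply: le_trans (ler_normB _ _) _; apply: lerD.
rewrite normrM (ger0_norm k0) => h4.
have := ler_wpM2l k0 h3; lra.
Qed.

Lemma strong_lenD (n m : nat) :
  len (h ^+ n)%g + 2 * delta * m%:R <= len (h ^+ (n + m))%g.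
Proof.
elim: m => [|m IH]; first by rewrite addn0; lra.
by rewrite addnS -natr1; have := strong_lenS hyp sh (n + m); lra.
Qed.

Lemma mixing_of_fixed_end M :
  exists s, mixing H (loxodromic len) M 1 s.
Proof.
pose K := P h h^-1%g + 2 * delta.
have d0 := d_gt0.
have K0 : 0 <= K by have := gprod_ge0 hyp h h^-1%g; rewrite /K; lra.
(* The Busemann value at [h ^+ (q * j)] is minus its length up to [2 * K], so two such values differ
   by more than [14 * delta]. Two failures would force at most this: [3 * delta] twice for
   smallness, [2 * delta] twice for the quasimorphism defect and twice for the change of index. *)
pose q := (Num.truncn ((14 * delta + 2 * K) / (2 * delta))).+1.
have qP : 14 * delta + 2 * K < 2 * delta * q%:R.
  rewrite (mulrC (2 * delta)) -ltr_pdivrMr ?mulr_gt0//; exact: truncnS_gt.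
pose f j := (h ^+ (q * j))%g.
exists [seq f j | j <- index_iota 0 M]; split.
- by rewrite size_map size_iota subn0.
- by move=> k /mapP[j _ ->]; exact: HX.
move=> g Hg; rewrite big_map big_mkord; apply: sum_at_most_one.
suff main (a b : nat) : (a < b)%N -> ~~ `[< loxodromic len (g * f a)%g >] ->
    ~~ `[< loxodromic len (g * f b)%g >] -> False.
  move=> a b bada badb; apply: val_inj; case: (ltngtP (val a) (val b)) => // ab.
    by case: (main a b).
  by case: (main b a).
move=> ab /asboolPn bada /asboolPn badb.
have small j : ~ loxodromic len (g * f j)%g ->
    forall N, exists2 n, (N <= n)%N & `|busemann n (g * f j)%g| < 3 * delta.
  move=> nlox N; apply: contrapT => no; apply: nlox; apply: loxodromic_of_busemann.
    by case: sgH => _ HM _; apply: HM => //; exact: HX.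
  exists N => n nN; rewrite leNgt; apply/negP => lt; apply: no; by exists n.
have [N1 h1] := busemannM (f a) Hg; have [N2 h2] := busemannM (f b) Hg.
have [N3 h3] := busemann_cauchy g; have [N4 h4] := busemann_cauchy (f a).
pose N := (N1 + N2 + N3 + N4 + q * a + q * b)%N.
(* Smallness is known only for arbitrarily late indices, possibly different for [a] and [b]; the
   Cauchy estimates [h3] and [h4] compare them. *)
have [n nN na] := small a bada N; have [m mN mb] := small b badb N.
have {}h1 := h1 n ltac:(rewrite /N in nN; lia).
have {}h2 := h2 m ltac:(rewrite /N in mN; lia).
have {}h3 := h3 n m ltac:(rewrite /N in nN; lia) ltac:(rewrite /N in mN; lia).
have {}h4 := h4 n m ltac:(rewrite /N in nN; lia) ltac:(rewrite /N in mN; lia).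
have ha : (q * a <= m)%N by rewrite /N in mN; lia.
have := strong_gprod_exp hyp sh ha; rewrite -/K -/(f a) => pa.
have lb := gprod_lel hyp (f b) (pow h m).
have hb : (q * b <= m)%N by rewrite /N in mN; lia.
have := strong_gprod_exp hyp sh hb; rewrite -/K -/(f b) => pb.
have la := gprod_lel hyp (f a) (pow h m).
have ba : (q * b = q * a + q * (b - a))%N by rewrite -mulnDr subnKC// ltnW.
have := strong_lenD (q * a) (q * (b - a)); rewrite -ba -/(f a) -/(f b).
have : q%:R <= (q * (b - a))%:R :> R by rewrite ler_nat leq_pmulr// subn_gt0.
move=> qq; have : 2 * delta * q%:R <= 2 * delta * (q * (b - a))%:R.
  by rewrite ler_pM2l// mulr_gt0.
have E1 : busemann m (f a) = len (f a) - 2 * P (f a) (pow h m) by [].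
have E2 : busemann m (f b) = len (f b) - 2 * P (f b) (pow h m) by [].
move: h1 h2 h3 h4 na mb; rewrite !ler_norml !ltr_norml.
move=> /andP[? ?] /andP[? ?] /andP[? ?] /andP[? ?] /andP[? ?] /andP[? ?].
by rewrite /pow in la lb E1 E2 *; lra.
Qed.

End Busemann.

(** If separated families of size [N] exist but none of size [N.+1], one of size [N] is maximal,
    hence represents every translate of the end of [h]. *)
Lemma orbit_dichotomy H h : is_subgroup H ->
  (forall N, exists t : nat -> G, (forall a, (a < N)%N -> H (t a)) /\
     forall a b, (a < N)%N -> (b < N)%N -> a != b ->
     ~ group_asym len (fun i => t a * pow h i)%g (fun i => t b * pow h i)%g) \/
  (exists T : seq G, (forall t, t \in T -> H t) /\ forall g, H g ->
     exists2 t, t \in T & group_asym len (fun i => t * pow h i)%g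
                                         (fun i => g * pow h i)%g).
Proof.
move=> sgH; pose Q N := exists t : nat -> G, (forall a, (a < N)%N -> H (t a)) /\
     forall a b, (a < N)%N -> (b < N)%N -> a != b ->
     ~ group_asym len (fun i => t a * pow h i)%g (fun i => t b * pow h i)%g.
case: (pselect (forall N, Q N)) => [|nQ]; [by left|right].
have [N QN nQN] : exists2 N, Q N & ~ Q N.+1.
  apply: contrapT => no; apply: nQ; elim; first by exists (fun=> 1%g).
  by move=> N QN; apply: contrapT => nQN; apply: no; exists N.
have [t [Ht sep]] := QN; exists [seq t a | a <- iota 0 N]; split.
  by move=> _ /mapP[a + ->]; rewrite mem_iota => /= aN; exact: Ht.
move=> g Hg; apply: contrapT => no; apply: nQN.
have {}no a : (a < N)%N -> ~ group_asym len (fun i => t a * pow h i)%g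
                                            (fun i => g * pow h i)%g.
  by move=> aN as_; apply: no; exists (t a) => //; apply: map_f; rewrite mem_iota.
exists (fun a => if (a < N)%N then t a else g); split=> [a aN|a b].
  by case: ifP => // aN'; exact: Ht.
rewrite !ltnS => aN bN ab; case: ltnP => aN'; case: ltnP => bN'.
- exact: sep.
- exact: no.
- by move/(group_asym_sym hyp); exact: no.
- by move: ab; rewrite (_ : a = b) ?eqxx//; lia.
Qed.

Lemma end_stabilizer_subgroup H h : is_subgroup H ->
  strongly_loxodromic len delta h ->
  is_subgroup [set g | H g /\ group_asym len (pow h) (fun n => g * pow h n)%g].
Proof.
move=> [H1 HM HV] sh; split=> /=.
- split=> //; rewrite (_ : (fun n => _) = pow h); first exact: (strong_asym hyp sh).
  by apply/funext => n; rewrite mul1g.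
- move=> g k [Hg ag] [Hk ak]; split; first exact: HM.
  apply: (group_asym_trans hyp ag).
  have := group_asym_translate hyp g ak.
  by congr group_asym; apply/funext => n; rewrite mulgA.
- move=> g [Hg ag]; split; first exact: HV.
  have := group_asym_translate hyp g^-1%g (group_asym_sym hyp ag).
  by congr group_asym; apply/funext => n; rewrite mulKg.
Qed.

Lemma asym_shift h : strongly_loxodromic len delta h ->
  group_asym len (pow h) (fun n => h * pow h n)%g.
Proof.
move=> sh; apply: (group_asym_close hyp (strong_asym hyp sh)) => n.
by rewrite /pow -expgS expgSr mulKg; exact: lexx.
Qed.

Lemma asym_subseq (u v : nat -> G) m : (0 < m)%N -> group_asym len u v ->
  group_asym len (fun n => u (m * n)%N) (fun n => v (m * n)%N).
Proof.
move=> m0 uv T; have [N hN] := uv T; exists N => n k nN kN.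
by apply: hN; [apply: leq_trans nN _|apply: leq_trans kN _]; rewrite leq_pmull.
Qed.

End FixedEnd.

(** * Simultaneous multipliers *)

Section Products.
Variables (G : groupType) (H : set G) (l M m : nat).
Variables (good : 'I_l -> set G) (s : 'I_l -> seq G).
Hypothesis sgH : is_subgroup H.
Hypothesis goodC : forall i g k, good i (g * k)%g -> good i (k * g)%g.
Hypothesis mix : forall i, mixing H (good i) M m (s i).

Definition products (r : seq 'I_l) : seq G :=
  foldr (fun i acc => [seq (f * w)%g | f <- s i, w <- acc]) [:: 1%g] r.

Lemma size_products r : size (products r) = (M ^ size r)%N.
Proof.
by elim: r => //= i r IH; rewrite size_allpairs IH expnS; have [-> _ _] := mix i.
Qed.

Lemma products_sub r k : k \in products r -> H k.
Proof.
have [H1 HM _] := sgH; elim: r k => [|i r IH] k; first by rewrite inE => /eqP ->.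
move=> /allpairsP[[f w] /= [fs ws ->]]; apply: HM; last exact: IH.
by have [_ + _] := mix i; apply.
Qed.

(* Conjugation by [w] turns [g f w] into [w g f], so that every factor of the
   product may be treated as the last one. *)
Lemma count_bad_products r g : H g ->
  ((\sum_(p <- products r) ~~ all (fun i => `[< good i (g * p)%g >]) r) * M
    <= size r * m * M ^ size r)%N.
Proof.
have [_ HM _] := sgH; elim: r g => [|i r IH] g Hg.
  by rewrite big1_seq.
have [szs Hs bad] := mix i.
rewrite big_allpairs_dep /=.
apply: (@leq_trans ((\sum_(f <- s i) \sum_(w <- products r)
    (~~ `[< good i (w * g * f)%g >] +
     ~~ all (fun j => `[< good j (g * f * w)%g >]) r)) * M)%N).
  rewrite leq_mul2r; apply/orP; right; apply: leq_sum => f _; apply: leq_sum => w _.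
  rewrite !mulgA negb_and; case: (boolP (all _ r)) => _; last first.
    by rewrite orbT addn1.
  rewrite orbF addn0; case: asboolP => // nb; case: asboolP => //.
  by rewrite -mulgA => /goodC.
under eq_bigr do rewrite big_split/=.
rewrite big_split/= mulnDl [X in (X * M + _)%N]exchange_big/= mulSn mulnDl.
apply: leq_add.
  rewrite expnS mulnA mulnAC leq_mul2r; apply/orP; right.
  rewrite mulnC -size_products -sum1_size big_distrl/=.
  rewrite [X in (X <= _)%N]big_seq [X in (_ <= X)%N]big_seq.
  apply: leq_sum => w hw; rewrite mul1n; apply: bad.
  by apply: HM => //; exact: products_sub hw.
rewrite big_distrl/= expnS [(M * _)%N]mulnC mulnA.
apply: (@leq_trans (\sum_(f <- s i) size r * m * M ^ size r)%N).
  rewrite [X in (X <= _)%N]big_seq [X in (_ <= X)%N]big_seq.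
  by apply: leq_sum => f hf; apply: IH; apply: HM => //; exact: Hs.
rewrite -szs -[X in (_ <= _ * X)%N]sum1_size big_distrr/=.
by apply: leq_sum => f _; rewrite muln1.
Qed.

(** If every product failed for some [g], the count would give [M ^ l * M <= l * m * M ^ l]. *)
Lemma exists_good_product : (l * m < M)%N ->
  exists F : seq G, (forall k, k \in F -> H k) /\
    forall g, H g -> exists2 k, k \in F & forall i, good i (g * k)%g.
Proof.
move=> lm; exists (products (enum 'I_l)); split; first exact: products_sub.
move=> g Hg; apply: contrapT => no.
have M0 : (0 < M)%N by case: M lm.
have := count_bad_products (enum 'I_l) Hg.
rewrite leqNgt => /negP; apply; rewrite size_enum_ord.
rewrite [X in (_ < X * _)%N](_ : _ = (M ^ l)%N).
  by rewrite mulnC ltn_pmul2l ?expn_gt0 ?M0.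
have -> : (M ^ l)%N = size (products (enum 'I_l)).
  by rewrite size_products size_enum_ord.
rewrite -sum1_size.
rewrite big_seq [RHS]big_seq; apply: eq_bigr => k kF.
case: allP => // hall; case: no; exists k => // i.
by apply/asboolP/hall; rewrite mem_enum.
Qed.

End Products.

(** Pigeonhole: two of the first [(size T).+1] powers of [h] lie in the same left coset of [K]. *)
Lemma finite_index_exp (G : groupType) (H K : set G) (T : seq G) h :
  is_subgroup H -> is_subgroup K ->
  (forall g, H g -> exists2 t, t \in T & K (t^-1 * g)%g) ->
  H h -> exists2 m, (0 < m)%N & K (h ^+ m)%g.
Proof.
move=> [H1 HM _] [_ KM KV] hT Hh.
have HX n : H (h ^+ n)%g.
  by elim: n => [|n IH]; rewrite ?expg0// expgS; exact: HM.
have /choice[t ht] : forall n, exists t, t \in T /\ K (t^-1 * h ^+ n)%g.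
  by move=> n; have [t ? ?] := hT _ (HX n); exists t.
have : ~~ uniq [seq t n | n <- iota 0 (size T).+1].
  apply/negP => us; have : {subset [seq t n | n <- iota 0 (size T).+1] <= T}.
    by move=> _ /mapP[n _ ->]; case: (ht n).
  by move=> /(uniq_leq_size us); rewrite size_map size_iota ltnn.
move=> /(uniqPn 1%g)[a [b [ab]]]; rewrite size_map size_iota => bT.
rewrite !(nth_map 0%N) ?size_iota ?(ltn_trans ab)// !nth_iota ?(ltn_trans ab)//.
rewrite !add0n => tab; exists (b - a)%N; first by rewrite subn_gt0.
have [_ Ka] := ht a; have [_ Kb] := ht b.
have := KM _ _ (KV _ Ka) Kb; rewrite tab invgM invgK -mulgA mulVKg.
by rewrite -{1}(subnKC (ltnW ab)) expgnDr mulKg.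
Qed.

(** * Induction on the number of actions without a fixed end *)

Section Multi.
Variables (R : realType) (G : groupType) (l : nat).
Variables (len : 'I_l -> G -> R) (delta : 'I_l -> R).
Hypothesis hyp : forall i, hyperbolic_length (len i) (delta i).

Definition separated_translates i (H : set G) h := forall n,
  exists t : nat -> G, (forall a, (a < n)%N -> H (t a)) /\
     forall a b, (a < n)%N -> (b < n)%N -> a != b ->
     ~ group_asym (len i) (fun k => t a * pow h k)%g (fun k => t b * pow h k)%g.

Definition infinite_orbits i (H : set G) : Prop :=
  exists h, [/\ strongly_loxodromic (len i) (delta i) h, H h,
    separated_translates i H h & separated_translates i H h^-1%g].

(** A power of [h] lies in [K], and a further power is again strongly loxodromic; its powers form a
    subsequence of those of [h], so its end is still fixed. *)
Lemma fixed_end_finite_index i (H K : set G) (T : seq G) :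
  is_subgroup H -> is_subgroup K -> K `<=` H ->
  (forall g, H g -> exists2 t, t \in T & K (t^-1 * g)%g) ->
  fixed_end (len i) (delta i) H -> fixed_end (len i) (delta i) K.
Proof.
move=> sgH sgK KH hT [h [sh Hh fh]].
have [m m0 Km] := finite_index_exp sgH sgK hT Hh.
have lox := loxodromic_exp m0 (strong_loxodromic (hyp i) sh).
have [m' m'0 sm] := loxodromic_strong_exp (hyp i) lox.
exists (h ^+ m ^+ m')%g; split=> //.
  elim: (m') => [|k IH]; rewrite ?expg0 ?expgS; first by case: sgK.
  by case: sgK => _ KM _; exact: KM.
move=> t /KH /fh; move/(asym_subseq (m := (m * m')%N)).
rewrite muln_gt0 m0 m'0 => /(_ isT); congr group_asym.
  by apply/funext => n; rewrite /pow !expgnA.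
by apply/funext => n; rewrite /pow !expgnA.
Qed.

(** Both cases are given the same parameters, as the products of families require. *)
Lemma mixing_of_fixed_or_infinite i H n : is_subgroup H -> (0 < n)%N ->
  fixed_end (len i) (delta i) H \/ infinite_orbits i H ->
  exists s, mixing H (loxodromic (len i)) (n * n) (2 * n) s.
Proof.
move=> sgH n0 [[h [sh Hh fh]]|[h [sh Hh /(_ n)[t [Ht st]] /(_ n)[r [Hr sr]]]]].
  have [s [? ? bad]] := mixing_of_fixed_end (hyp i) sgH sh Hh fh (n * n).
  by exists s; split=> // g Hg; apply: leq_trans (bad g Hg) _; lia.
exact: (mixing_of_infinite_orbits sgH (hyp i) sh Hh Ht Hr st sr).
Qed.

(* As long as some action has an end with a finite, non-trivial orbit, pass to
   the stabilizer of this end. *)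
Theorem exists_loxodromic_multipliers (H : set G) : is_subgroup H ->
  (forall i, exists2 h, H h & loxodromic (len i) h) ->
  exists F : seq G, forall g, H g ->
    exists2 k, k \in F & forall i, loxodromic (len i) (g * k)%g.
Proof.
pose moving (H : set G) := [set i | ~~ `[< fixed_end (len i) (delta i) H >]]%SET.
have [n] := ubnP #|moving H|; elim: n H => // n IH H Hn sgH hlox.
case: (pselect (forall i, fixed_end (len i) (delta i) H \/ infinite_orbits i H)).
  (* This gives [l * (2 * N) < N * N]. *)
  move=> all_i; pose N := (2 * l).+1.
  have /choice[s hs] : forall i, exists s,
      mixing H (loxodromic (len i)) (N * N) (2 * N) s.
    by move=> i; exact: mixing_of_fixed_or_infinite.
  have conj i g k : loxodromic (len i) (g * k)%g -> loxodromic (len i) (k * g)%g.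
    exact: loxodromicC (hyp i) _ _.
  have [|F [_ hF]] := exists_good_product sgH conj hs; first by rewrite /N; nia.
  by exists F.
move=> /existsNP[i /not_orP[nfix ninf]].
have [h0 Hh0 lox0] := hlox i; have [m m0 sh] := loxodromic_strong_exp (hyp i) lox0.
have HX k : H (h0 ^+ k)%g.
  case: sgH => H1 HM _.
  by elim: k => [|k IHk]; rewrite ?expg0// expgS; exact: HM.
(* One of the two ends of [h0 ^+ m] has only finitely many translates, since otherwise
   [infinite_orbits] would hold. *)
have [e [He se [T [HT hT]]]] : exists e, [/\ H e,
    strongly_loxodromic (len i) (delta i) e &
    exists T : seq G, (forall t, t \in T -> H t) /\ forall g, H g ->
     exists2 t, t \in T & group_asym (len i) (fun n => t * pow e n)%g
                                             (fun n => g * pow e n)%g].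
  have HV : H (h0 ^+ m)^-1%g by case: sgH => _ _; apply.
  case: (orbit_dichotomy (hyp i) (h0 ^+ m)%g sgH) => [t1|T1]; last first.
    by exists (h0 ^+ m)%g; split.
  case: (orbit_dichotomy (hyp i) (h0 ^+ m)^-1%g sgH) => [t2|T2]; last first.
    by exists (h0 ^+ m)^-1%g; split=> //; exact: strongly_loxodromicV.
  by case: ninf; exists (h0 ^+ m)%g; split.
pose K := [set g | H g /\ group_asym (len i) (pow e) (fun n => g * pow e n)%g].
have sgK : is_subgroup K := end_stabilizer_subgroup (hyp i) sgH se.
have KH : K `<=` H by move=> g [].
have idx g : H g -> exists2 t, t \in T & K (t^-1 * g)%g.
  move=> Hg; have [t tT tg] := hT g Hg; exists t => //; split.
    by case: sgH => _ HM HV; apply: HM => //; apply: HV; exact: HT.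
  have := group_asym_translate (hyp i) t^-1%g tg; congr group_asym.
    by apply/funext => k; rewrite mulKg.
  by apply/funext => k; rewrite mulgA.
have fixK : fixed_end (len i) (delta i) K.
  exists e; split=> //; first by split=> //; exact: (asym_shift (hyp i)).
  by move=> t [].
have Kn : (#|moving K| < n)%N.
  rewrite ltnS in Hn; apply: leq_trans Hn; apply: proper_card; apply/properP; split.
    apply/fintype.subsetP => j; rewrite !inE; apply: contra => /asboolP fj; apply/asboolP.
    exact: fixed_end_finite_index idx fj.
  exists i; rewrite !inE; first by apply/asboolPn.
  by apply/negPn/asboolP.
have Klox j : exists2 h, K h & loxodromic (len j) h.
  have [h Hh lox] := hlox j; have [k k0 Kk] := finite_index_exp sgH sgK idx Hh.
  by exists (h ^+ k)%g => //; exact: loxodromic_exp.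
have [F hF] := IH K Kn sgK Klox.
(* First multiply by [t] to bring [g] into [K], then by a multiplier for [K]; the coset of [g^-1]
   provides [t]. *)
exists [seq (t * k)%g | t <- T, k <- F] => g Hg.
have [t tT Kt] : exists2 t, t \in T & K (g * t)%g.
  have [t tT Kt] := idx g^-1%g ltac:(by case: sgH => _ _; apply); exists t => //.
  by case: sgK => _ _ /(_ _ Kt); rewrite invgM !invgK.
have [k kF hk] := hF _ Kt; exists (t * k)%g; first exact: allpairs_f.
by move=> j; rewrite mulgA.
Qed.

End Multi.

(** * Loxodromic and hyperbolic elements *)

Lemma card_set2 (T : Type) (a b : T) : a <> b -> ([set a; b] #= `I_2)%card.
Proof.
move=> ab; apply/eq_cardSP; exists a; first by left.
rewrite (_ : _ `\ _ = [set b]); first exact: card_set1.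
apply/seteqP; split=> x /=; first by move=> [[->|->]].
by move=> ->; split; [right|exact: nesym].
Qed.

Lemma exists_two_points (T : Type) (A : set T) :
  ~ (A #= `I_0)%card -> ~ (A #= `I_1)%card -> exists a b, [/\ A a, A b & a <> b].
Proof.
move=> n0 n1; have [A0|/set0P[a Aa]] := eqVneq A set0.
  by case: n0; rewrite A0 II0 card_eq0.
exists a; apply: contrapT => no; apply: n1.
rewrite (_ : A = [set a]); first exact: card_set1.
apply/seteqP; split=> [b Ab|_ -> //]; apply: contrapT => /= ba; apply: no.
by exists b; split=> // /esym.
Qed.

Section Action.
Variables (R : realType) (X : metricType R) (G : groupType).
Variables (act : G -> X -> X) (x : X) (delta : R).
Hypothesis iso : isometric_action act.
Hypothesis d_gt0 : 0 < delta.
Hypothesis fp : four_point X delta.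
Implicit Types (g h : G) (u v w : nat -> X).

Let act1 y : act 1%g y = y. Proof. by case: iso. Qed.
Let actM g h y : act (g * h)%g y = act g (act h y). Proof. by case: iso. Qed.
Let act_iso g y z : mdist (act g y) (act g z) = mdist y z. Proof. by case: iso. Qed.
Let actK g y : act g^-1%g (act g y) = y. Proof. by rewrite -actM mulVg act1. Qed.
Let actKV g y : act g (act g^-1%g y) = y. Proof. by rewrite -actM mulgV act1. Qed.
Let distV g y z : mdist y (act g z) = mdist (act g^-1%g y) z.
Proof. by rewrite -(act_iso g^-1%g) actK. Qed.

Definition orbit_length g : R := mdist (act g x) x.
Local Notation len := orbit_length.
Definition orbit (u : nat -> G) : nat -> X := fun n => act (u n) x.

Lemma gprod_orbit g h : gprod len g h = gromov_product x (act g x) (act h x).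
Proof.
rewrite /gprod /gromov_product /len actM; congr ((_ - _) / 2).
by rewrite metric_sym -(act_iso g x) actKV.
Qed.

Lemma orbit_length_hyperbolic : hyperbolic_length len delta.
Proof.
split.
- by rewrite /len act1 mdistxx.
- by move=> g; rewrite /len metric_sym distV invgK.
- move=> g h; rewrite /len actM.
  by have := metric_triangle (act g (act h x)) (act g x) x; rewrite act_iso; lra.
- by split=> // g h k; rewrite !gprod_orbit; exact: fp.
Qed.
Let hyp := orbit_length_hyperbolic.

Lemma group_asymE (u v : nat -> G) :
  group_asym len u v <-> asym x (orbit u) (orbit v).
Proof.
split=> h T; have [N hN] := h T; exists N => n m nN mN.
  by rewrite /orbit -gprod_orbit; exact: hN.
by rewrite gprod_orbit; exact: hN.
Qed.

Lemma boundary_class_eq u v : asym x u v -> boundary_class x u = boundary_class x v.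
Proof.
move=> uv; apply/seteqP; split=> w [cw]; rewrite /boundary_class /= !asymptoticE => h.
  by split=> //; apply: asym_trans fp (asym_sym uv) h.
by split=> //; apply: asym_trans fp uv h.
Qed.

Lemma boundary_class_asym u v : asym x u u ->
  boundary_class x u = boundary_class x v -> asym x u v.
Proof.
move=> uu e; have : boundary_class x u u.
  by rewrite /boundary_class /= /converges_at_infinity !asymptoticE.
by rewrite e => -[_ /asymptoticE /asym_sym].
Qed.

Lemma exists_loxodromic : ~ elliptic_action act x -> ~ horocyclic_action act x ->
  exists g, loxodromic len g.
Proof.
move=> nell nhor.
have [xi [eta [[u /= [uu ->]] [v /= [vv ->]] uv]]] := exists_two_points nell nhor.
have {}uu : group_asym len u u by apply/group_asymE/asymptoticE.
have {}vv : group_asym len v v by apply/group_asymE/asymptoticE.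
have {}uv : ~ group_asym len u v.
  by move=> /group_asymE/boundary_class_eq.
have [n [m [] s]] := strong_of_divergent hyp uu vv uv; eexists;
  exact: (strong_loxodromic hyp s).
Qed.

Lemma asym_act g u v : asym x u v ->
  asym x (fun n => act g (u n)) (fun n => act g (v n)).
Proof.
move=> h T; have [N hN] := h (T + len g); exists N => n m nN mN.
have := hN n m nN mN; have := gromov_product_base x (act g^-1%g x) (u n) (v m).
have -> : gromov_product x (act g (u n)) (act g (v m)) =
          gromov_product (act g^-1%g x) (u n) (v m).
  by rewrite -{1}(actKV g x) /gromov_product !act_iso.
have -> : mdist x (act g^-1%g x) = len g by rewrite -(act_iso g) actKV.
by lra.
Qed.

Lemma boundary_act_class g u :
  boundary_act act g (boundary_class x u) = boundary_class x (fun n => act g (u n)).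
Proof.
apply/seteqP; split=> [_ [v [cv uv] <-]|w [cw uw]].
  move: cv uv; rewrite /boundary_class /= /converges_at_infinity !asymptoticE.
  by move=> cv uv; split; exact: asym_act.
exists (fun n => act g^-1%g (w n)); last by apply/funext => n; rewrite actKV.
move: cw uw; rewrite /boundary_class /= /converges_at_infinity !asymptoticE => cw uw.
split; first exact: asym_act.
have := asym_act g^-1%g uw; congr asym.
by apply/funext => n; rewrite actK.
Qed.

Lemma boundary_actM g h xi :
  boundary_act act (g * h)%g xi = boundary_act act g (boundary_act act h xi).
Proof.
rewrite /boundary_act image_comp; congr image.
by apply/funext => u /=; apply/funext => n; rewrite actM.
Qed.

Lemma boundary_actX g n xi : boundary_act act g xi = xi ->
  boundary_act act (g ^+ n)%g xi = xi.
Proof.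
move=> e; elim: n => [|n IH]; last by rewrite expgS boundary_actM IH.
rewrite expg0 /boundary_act -[RHS]image_id; congr image.
by apply/funext => u; apply/funext => m; rewrite act1.
Qed.

(** * Boundary points fixed by powers of a strongly loxodromic element *)

Section FixedPoints.
Variable p : G.
Hypothesis sp : strongly_loxodromic len delta p.

(* Let [y = p^k x]. If [u] stays away from both ends of [p], then so does
   [v = p^k u], and [(u_n | y)] is bounded while [(v_n | y)] is about
   [d(y, x)]; but these differ by at most [delta] when [u] and [v] are
   asymptotic. *)
Lemma fixed_by_powers_asym u : asym x u u ->
  (forall k, asym x u (fun n => act (p ^+ k)%g (u n))) ->
  asym x u (orbit (pow p)) \/ asym x u (orbit (pow p^-1%g)).
Proof.
move=> uu hu; apply: contrapT => /not_orP[n1 n2].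
have pp : asym x (orbit (pow p)) (orbit (pow p)).
  exact/group_asymE/(strong_asym hyp sp).
have qq : asym x (orbit (pow p^-1%g)) (orbit (pow p^-1%g)).
  exact/group_asymE/(strong_asym hyp (strongly_loxodromicV hyp sp)).
have [M1 M10 [N1 h1]] := not_asym_bounded fp uu pp n1.
have [M2 M20 [N2 h2]] := not_asym_bounded fp uu qq n2.
have [N3 h3] := strong_asym hyp sp (M1 + M2 + delta + 1).
pose k := maxn N1 (maxn N2 N3).
have [k1 k2 k3] : [/\ (N1 <= k)%N, (N2 <= k)%N & (N3 <= k)%N] by rewrite /k; split; lia.
have lk : M1 + M2 + delta + 1 <= len (p ^+ k)%g.
  by have := h3 k k k3 k3; rewrite (gprodgg hyp).
have [N4 h4] := hu k (len (p ^+ k)%g + delta + 1).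
pose n := maxn N1 (maxn N2 N4).
have [m1 m2 m4] : [/\ (N1 <= n)%N, (N2 <= n)%N & (N4 <= n)%N] by rewrite /n; split; lia.
have := h1 n k m1 k1; have := h2 n k m2 k2; have := h4 n n m4 m4.
rewrite /orbit /pow expVgn; set y := act (p ^+ k)%g x; set v := act (p ^+ k)%g (u n).
(* Translation by [p ^+ k] turns the upper bound [M2] on [(u_n | p^-k x)] into the lower bound
   [len (p ^+ k) - M2] on [(v | y)]. *)
have vx : mdist v x = mdist (u n) (act (p ^- k)%g x) by rewrite distV invgK.
have vy : mdist v y = mdist (u n) x by rewrite act_iso.
have lV : mdist (act (p ^- k)%g x) x = mdist y x.
  by rewrite metric_sym distV invgK.
have ly : mdist y x = len (p ^+ k)%g by [].
have vyle : gromov_product x v y <= gromov_product x (u n) y + delta.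
  case: (fp x (u n) y v) => // a1.
  have := gromov_product_lel x y (u n); rewrite (gromov_productC x y (u n)) ly.
  by have := h4 n n m4 m4; rewrite -/v; lra.
move: vyle; rewrite /gromov_product vx vy lV ly; lra.
Qed.

(** By commutation, [g] displaces every point [q^n x] by the same distance [len g]. *)
Lemma asym_commute g q : strongly_loxodromic len delta q -> commute g q ->
  asym x (orbit (pow q)) (fun n => act g (orbit (pow q) n)).
Proof.
move=> sq gq.
have : group_asym len (pow q) (fun n => g * pow q n)%g.
  apply: (group_asym_close hyp (strong_asym hyp sq)) => n.
  by rewrite (commuteX n gq) mulKg; exact: lexx.
move=> /group_asymE; congr asym.
by apply/funext => n; rewrite /orbit actM.
Qed.

End FixedPoints.

Lemma loxodromic_not_elliptic g : loxodromic len g -> ~ elliptic_element act g.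
Proof.
move=> [e [c [e0 hg]]] /(_ x)[M hM].
pose n := (Num.truncn ((M + c) / e)).+1.
have : M + c < e * n%:R by rewrite mulrC -ltr_pdivrMr//; exact: truncnS_gt.
have := hg n; have := hM (act (g ^+ n)%g x) x; rewrite -/(len _).
move=> /(_ _ _) hM' h1 h2; suff : len (g ^+ n)%g <= M by lra.
apply: hM'; first by exists (g ^+ n)%g => //; exists n; left.
by exists 1%g => //; exists 0%N; left; rewrite expg0.
Qed.

(** A strongly loxodromic power [p] of [g] has two distinct ends, fixed by [g] because [g] commutes
    with [p]. Conversely a point fixed by [g] is fixed by all powers of [p], hence is one of these
    ends. *)
Lemma loxodromic_hyperbolic g : loxodromic len g -> hyperbolic_element act x g.
Proof.
move=> lg; split; first exact: loxodromic_not_elliptic.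
have [m m0 sp] := loxodromic_strong_exp hyp lg; set p := (g ^+ m)%g in sp.
have spV := strongly_loxodromicV hyp sp.
have comm : commute g p by exact: commuteX.
have pp := strong_asym hyp sp; have qq := strong_asym hyp spV.
pose a := boundary_class x (orbit (pow p)).
pose b := boundary_class x (orbit (pow p^-1%g)).
rewrite (_ : boundary_fixed_points act x g = [set a; b]).
  apply: card_set2 => /boundary_class_asym; rewrite -!group_asymE => /(_ pp).
  exact: (strong_asymV hyp sp).
apply/seteqP; split=> [xi [[u cu ->] fx]|_ [->|->]]; last 2 first.
- split; first by exists (orbit (pow p)) => //; exact/asymptoticE/group_asymE.
  rewrite boundary_act_class; apply/esym/boundary_class_eq.
  exact: asym_commute.
- split; first by exists (orbit (pow p^-1%g)) => //; exact/asymptoticE/group_asymE.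
  rewrite boundary_act_class; apply/esym/boundary_class_eq.
  by apply: asym_commute => //; apply: commuteV.
have uu : asym x u u by exact/asymptoticE.
have [k|ua|ub] := fixed_by_powers_asym sp uu.
- apply: boundary_class_asym => //; rewrite -boundary_act_class.
  by rewrite /p -expgnA boundary_actX.
- by left; exact: boundary_class_eq.
- by right; exact: boundary_class_eq.
Qed.

End Action.

(** * Density in balls *)

Lemma card_set_le_image2 (T : choiceType) (A C : set T) (s : seq T)
    (f : T -> T -> T) : finite_set A -> finite_set C ->
  (forall c, C c -> exists a b, [/\ A a, b \in s & c = f a b]) ->
  (card_set C <= card_set A * size s)%N.
Proof.
move=> fA fC h; rewrite /card_set -(size_allpairs f).
apply: uniq_leq_size; first exact: fset_uniq.
move=> c; rewrite in_fset_set// inE => /h[a [b [Aa bs ->]]].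
by apply: allpairs_f => //; rewrite in_fset_set// inE.
Qed.

Section WordBalls.
Variables (G : groupType) (S : {fset G}).
Local Notation B := (word_ball S).

Lemma word_ball1 n : B n 1%g.
Proof. by exists [::]; rewrite big_nil. Qed.

Lemma word_ball_mono n m g : (n <= m)%N -> B n g -> B m g.
Proof. by move=> nm [w [sw lw ->]]; exists w; split=> //; exact: leq_trans nm. Qed.

Lemma word_ballM n m g h : B n g -> B m h -> B (n + m) (g * h)%g.
Proof.
move=> [w [sw lw ->]] [v [sv lv ->]]; exists (w ++ v); split.
- by rewrite size_cat leq_add.
- by move=> x; rewrite mem_cat => /orP[/lw|/lv].
- by rewrite big_cat.
Qed.

Lemma word_ballV n g : B n g -> B n g^-1%g.
Proof.
move=> [w [sw lw ->]]; exists [seq x^-1%g | x <- rev w]; split.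
- by rewrite size_map size_rev.
- move=> _ /mapP[x + ->]; rewrite mem_rev => /lw[]; rewrite /letter; last by left.
  by right; rewrite invgK.
- by rewrite big_map prodgV revK.
Qed.

Lemma word_ball_split n m g : B (n + m) g ->
  exists a b, [/\ B n a, B m b & g = (a * b)%g].
Proof.
move=> [w [sw lw ->]]; exists (\prod_(x <- take n w) x)%g, (\prod_(x <- drop n w) x)%g.
split.
- exists (take n w); split=> //; first by rewrite size_take_min geq_minl.
  by move=> x /mem_take /lw.
- exists (drop n w); split=> //; first by rewrite size_drop leq_subLR.
  by move=> x /mem_drop /lw.
- by rewrite -big_cat/= cat_take_drop.
Qed.

Lemma word_ball_finite n : finite_set (B n).
Proof.
elim: n => [|n IH].
  apply: (@sub_finite_set _ _ [set 1%g]); last exact: finite_set1.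
  by move=> g [w []]; rewrite leqn0 size_eq0 => /eqP -> _ ->; rewrite big_nil.
have f1 : finite_set (B 1).
  apply: (@sub_finite_set _ _ ([set` S] `|` [set x^-1%g | x in [set` S]] `|` [set 1%g])).
    move=> g [[|x [|y w]] [sw lw ->]] //; first by right; rewrite big_nil.
    rewrite big_seq1; left; have [|xS|xS] := lw x; first exact: mem_head.
      by left.
    by right; exists x^-1%g => //; rewrite invgK.
  rewrite !finite_setU; split; last exact: finite_set1.
  by split; [exact: finite_fset|apply: finite_image; exact: finite_fset].
apply: (@sub_finite_set _ _ [set (a * b)%g | a in B 1 & b in B n]).
  by move=> g; rewrite -add1n => /word_ball_split[a [b [Ba Bb ->]]]; exists a => //;
    exists b.
exact: finite_image2.
Qed.

Lemma generates_word_ball : generates S -> forall g, exists n, B n g.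
Proof.
move=> gen; pose W : set G := [set g | exists n, B n g].
suff e : W = setT by move=> g; have : W g by rewrite e.
apply: gen; first split.
- by exists 0%N; exact: word_ball1.
- by move=> g h [n gn] [m hm]; exists (n + m)%N; exact: word_ballM.
- by move=> g [n gn]; exists n; exact: word_ballV.
move=> s sS; exists 1%N, [:: s]; split; rewrite ?big_seq1//.
by move=> x; rewrite inE => /eqP ->; left.
Qed.

Lemma word_ball_seq (F : seq G) : generates S ->
  exists k, forall f, f \in F -> B k f.
Proof.
move=> gen; elim: F => [|f F [k hk]]; first by exists 0%N.
have [n fn] := generates_word_ball gen f; exists (maxn n k) => g.
rewrite inE => /orP[/eqP ->|/hk]; first exact: word_ball_mono (leq_maxl _ _) fn.
exact: word_ball_mono (leq_maxr _ _).
Qed.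

(** Shrinking the radius by [k] divides the size of the ball by at most that of the ball of radius
    [k]. *)
Lemma positive_density (R : realType) (A : set G) (F : seq G) : generates S ->
  (forall g, exists2 f, f \in F & A (g * f)%g) ->
  exists c : R, 0 < c < 1 /\ exists N : nat, forall n : nat, (N <= n)%N ->
    c < (card_set (B n `&` A))%:R / (card_set (B n))%:R.
Proof.
move=> gen hF; have [k Fk] := word_ball_seq F gen.
have pos n : (0 < card_set (B n))%N.
  rewrite /card_set cardfs_gt0; apply/fset0Pn; exists 1%g.
  by rewrite in_fset_set ?inE; [exact: word_ball1|exact: word_ball_finite].
have F0 : (0 < size F)%N by have [f + _] := hF 1%g; case: (F).
pose K := (size F * card_set (B k))%N.
have K0 : (0 < K)%N by rewrite muln_gt0 F0 pos.
have K1 : (1 : R) <= K%:R by rewrite ler1n.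
have K2 : (0 : R) < 2 * K%:R by lra.
(* The factor 2 gives both [c < 1] when [K = 1] and the strict inequality. *)
exists (2 * K%:R)^-1; split.
  by rewrite invr_gt0 K2 invf_lt1//; lra.
exists k => n kn.
have le1 : (card_set (B n) <= card_set (B (n - k)) * card_set (B k))%N.
  apply: (card_set_le_image2 (f := fun a b => a * b)%g).
  - exact: word_ball_finite.
  - exact: word_ball_finite.
  move=> g; rewrite -{1}(subnK kn) => /word_ball_split[a [b [Ba Bb ->]]].
  exists a, b; split=> //; rewrite in_fset_set ?inE//; exact: word_ball_finite.
have le2 : (card_set (B (n - k)) <= card_set (B n `&` A) * size F)%N.
  apply: (card_set_le_image2 (f := fun a b => a * b^-1)%g).
  - by apply: finite_setIl; exact: word_ball_finite.
  - exact: word_ball_finite.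
  move=> g Bg; have [f fF Af] := hF g; exists (g * f)%g, f; split=> //.
    by split=> //; rewrite -(subnK kn); apply: word_ballM => //; exact: Fk.
  by rewrite mulgK.
have le3 : ((card_set (B n))%:R : R) <= (card_set (B n `&` A))%:R * K%:R.
  rewrite -natrM ler_nat; apply: leq_trans le1 _; rewrite /K mulnA leq_mul2r.
  by rewrite le2 orbT.
have Bn0 : (0 : R) < (card_set (B n))%:R by rewrite ltr0n.
rewrite ltr_pdivlMr// mulrC ltr_pdivrMr//; nra.
Qed.

End WordBalls.

Theorem theorem1p2 (R : realType) (G : groupType) (S : {fset G}) (l : nat)
    (X : 'I_l -> metricType R) (act : forall i : 'I_l, G -> X i -> X i)
    (x0 : forall i : 'I_l, X i) :
  (1 <= l)%N ->
  generates S ->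
  (forall i, gromov_hyperbolic (X i)) ->
  (forall i, isometric_action (act i)) ->
  (forall i, ~ elliptic_action (act i) (x0 i)) ->
  (forall i, ~ horocyclic_action (act i) (x0 i)) ->
  exists c : R, 0 < c < 1 /\
    exists N : nat, forall n : nat, (N <= n)%N ->
      c < (card_set (word_ball S n `&` simultaneously_hyperbolic act x0))%:R
          / (card_set (word_ball S n))%:R.
Proof.
move=> _ gen hypX iso nell nhor.
have /choice[delta hd] : forall i, exists d, 0 < d /\ four_point (X i) d.
  by move=> i; have [d ? ?] := gromov_hyperbolic_four_point (hypX i); exists d.
have hyp i := orbit_length_hyperbolic (x0 i) (iso i) (hd i).1 (hd i).2.
have lox i : exists2 h, setT h & loxodromic (orbit_length (act i) (x0 i)) h.
  have [g lg] := exists_loxodromic (iso i) (hd i).1 (hd i).2 (nell i) (nhor i).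
  by exists g.
have [//|F hF] := exists_loxodromic_multipliers hyp _ lox.
apply: (@positive_density G S R _ F) => // g; have [//|f fF hf] := hF g.
exists f => // i; exact: loxodromic_hyperbolic (iso i) (hd i).1 (hd i).2 _ (hf i).
Qed.
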